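(* Suppose the basic penalty alternating direction method (described in the context) is run with $\overline\tau=\infty$ and penalty parameters $\rho_\tau>0$ with $\lim_{\tau\to\infty}\rho_\tau=\infty$. Let $(p^{(\tau)},q^{(\tau)},u^{(\tau)},\overline p^{(\tau)},\overline q^{(\tau)},\overline u^{(\tau)})$ be the iterates it generates, where the subproblems $Z^{\mathrm T}_t$ and $Z^{\mathrm J}_j$ are solved to global optimality. Then any limit point $(p^*,q^*,u^*,\overline p^*,\overline q^*,\overline u^* )$ of the sequence of iterates is a partial optimum for the problem COPY.
   Context: **Index sets.** $\mathcal T=\{1,\dots,T\}$ are time periods with lengths $d_t>0$. $\mathcal J^{\mathrm{pr}},\mathcal J^{\mathrm{cs}}$ are disjoint finite sets of producing and consuming devices, $\mathcal J^{\mathrm{sd}}=\mathcal J^{\mathrm{pr}}\cup\mathcal J^{\mathrm{cs}}$; $\mathcal I$ is the finite set of buses; $\mathcal J^{\mathrm{ac}},\mathcal J^{\mathrm{dc}}$ are the finite sets of AC and DC branches, $\mathcal J^{\mathrm{br}}$ their disjoint union, branch $j$ going from bus $i_j$ to bus $i'_j$; $\mathcal J^{\mathrm{sh}}$ is the finite set of shunts; each device or shunt $j$ sits at bus $i_j$; $\mathcal R$ is a finite set of real reserve products. $[x]^+=\max\{x,0\}$. A subscript $j$ or $t$ on $p,q,u$ denotes the sub-collection of variables with that index. **Device constraints** ($j\in\mathcal J^{\mathrm{sd}}$, $t\in\mathcal T$; $u^{\mathrm{on}}_{j0}\in\{0,1\}$ and $p^{\mathrm{tot}}_{j0}$ are data).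 Data: $p^{\mathrm{supc}}_{jtt'},p^{\mathrm{sdpc}}_{jtt'}\ge0$, $\mathcal T^{\mathrm{supc}}_{jt}=\{t'\in\mathcal T:t'>t,\ p^{\mathrm{supc}}_{jtt'}>0\}$, $\mathcal T^{\mathrm{sdpc}}_{jt}=\{t'\in\mathcal T:t'\le t,\ p^{\mathrm{sdpc}}_{jtt'}>0\}$; polyhedra $\mathcal X^{\mathrm u}_j$ (linear commitment rules) and $\mathcal X^{\mathrm p}_{jt}$ (linear power/reserve bounds); reals $q^{\max}_{jt},q^{\min}_{jt},\beta^{\max}_j,\beta^{\min}_j$ and ramp rates $p^{\mathrm{ru}}_j,p^{\mathrm{rd}}_j,p^{\mathrm{ru,su}}_j,p^{\mathrm{rd,sd}}_j$. (U) $u^{\mathrm{on}}_{jt}-u^{\mathrm{on}}_{j,t-1}=u^{\mathrm{su}}_{jt}-u^{\mathrm{sd}}_{jt}$; $u^{\mathrm{su}}_{jt}+u^{\mathrm{sd}}_{jt}\le1$; $\{u^{\mathrm{on}}_{jt},u^{\mathrm{su}}_{jt},u^{\mathrm{sd}}_{jt}\}_{t\in\mathcal T}\in\mathcal X^{\mathrm u}_j$; $u^{\mathrm{on}}_{jt},u^{\mathrm{su}}_{jt},u^{\mathrm{sd}}_{jt}\in\{0,1\}$. (P1) $p^{\mathrm{tot}}_{jt}=p^{\mathrm{on}}_{jt}+p^{\mathrm{su}}_{jt}+p^{\mathrm{sd}}_{jt}$. (P2) $p^{\mathrm{su}}_{jt}=\sum_{t'\in\mathcal T^{\mathrm{supc}}_{jt}}p^{\mathrm{supc}}_{jtt'}u^{\mathrm{su}}_{jt'}$,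 $p^{\mathrm{sd}}_{jt}=\sum_{t'\in\mathcal T^{\mathrm{sdpc}}_{jt}}p^{\mathrm{sdpc}}_{jtt'}u^{\mathrm{sd}}_{jt'}$. (P3) $(u^{\mathrm{on}}_{jt},p^{\mathrm{tot}}_{jt},p^{\mathrm{on}}_{jt},\{p^{\mathrm{res}}_{jtr}\}_{r\in\mathcal R})\in\mathcal X^{\mathrm p}_{jt}$. (P4) $p^{\mathrm{tot}}_{jt},p^{\mathrm{on}}_{jt},p^{\mathrm{res}}_{jtr}\ge0$. (Q) With $\sigma_{jt}:=u^{\mathrm{on}}_{jt}+\sum_{t'\in\mathcal T^{\mathrm{supc}}_{jt}}u^{\mathrm{su}}_{jt'}+\sum_{t'\in\mathcal T^{\mathrm{sdpc}}_{jt}}u^{\mathrm{sd}}_{jt'}$: $q^{\mathrm{tot}}_{jt}\le q^{\max}_{jt}\sigma_{jt}+\beta^{\max}_jp^{\mathrm{tot}}_{jt}-q^{\mathrm{res}}_{jta}$ and $q^{\mathrm{tot}}_{jt}\ge q^{\min}_{jt}\sigma_{jt}+\beta^{\min}_jp^{\mathrm{tot}}_{jt}+q^{\mathrm{res}}_{jtb}$, where $(a,b)=(\uparrow,\downarrow)$ if $j\in\mathcal J^{\mathrm{pr}}$ and $(a,b)=(\downarrow,\uparrow)$ if $j\in\mathcal J^{\mathrm{cs}}$; $q^{\mathrm{res}}_{jt\uparrow},q^{\mathrm{res}}_{jt\downarrow}\ge0$. (R) $-d_t\big(p^{\mathrm{rd}}_ju^{\mathrm{on}}_{jt}+p^{\mathrm{rd,sd}}_j(1-u^{\mathrm{on}}_{jt})\big)\le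 p^{\mathrm{tot}}_{jt}-p^{\mathrm{tot}}_{j,t-1}\le d_t\big(p^{\mathrm{ru}}_j(u^{\mathrm{on}}_{jt}-u^{\mathrm{su}}_{jt})+p^{\mathrm{ru,su}}_j(u^{\mathrm{su}}_{jt}-u^{\mathrm{on}}_{jt}+1)\big)$. **Network constraints** ($t\in\mathcal T$; $g,b$ with indices are real data). (F1) For $j\in\mathcal J^{\mathrm{ac}}$: $\Delta_{jt}=\theta_{i_jt}-\theta_{i'_jt}-\phi_{jt}$; $p^{\mathrm{fr}}_{jt}=v_{i_jt}\big(g_{i_jj}v_{i_jt}/\tau_{jt}^2+\frac{v_{i'_jt}}{\tau_{jt}}(-g_j\cos\Delta_{jt}-b_j\sin\Delta_{jt})\big)$; $p^{\mathrm{to}}_{jt}=v_{i'_jt}\big(g_{i'_jj}v_{i'_jt}+\frac{v_{i_jt}}{\tau_{jt}}(-g_j\cos\Delta_{jt}+b_j\sin\Delta_{jt})\big)$; $q^{\mathrm{fr}}_{jt}=v_{i_jt}\big(-b_{i_jj}v_{i_jt}/\tau_{jt}^2+\frac{v_{i'_jt}}{\tau_{jt}}(b_j\cos\Delta_{jt}-g_j\sin\Delta_{jt})\big)$; $q^{\mathrm{to}}_{jt}=v_{i'_jt}\big(-b_{i'_jj}v_{i'_jt}+\frac{v_{i_jt}}{\tau_{jt}}(b_j\cos\Delta_{jt}+g_j\sin\Delta_{jt})\big)$. (F2) $p^{\mathrm{fr}}_{jt}+p^{\mathrm{to}}_{jt}=0$ for $j\in\mathcal J^{\mathrm{dc}}$;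 $p^{\mathrm{sh}}_{jt}=g^{\mathrm{sh}}_ju^{\mathrm{sh}}_{jt}v_{i_jt}^2$ and $q^{\mathrm{sh}}_{jt}=-b^{\mathrm{sh}}_ju^{\mathrm{sh}}_{jt}v_{i_jt}^2$ for $j\in\mathcal J^{\mathrm{sh}}$. (F3) $v_{it}\in[v^{\min}_i,v^{\max}_i]$ for $i\in\mathcal I$; $\phi_{jt}\in[\phi^{\min}_j,\phi^{\max}_j]$, $\tau_{jt}\in[\tau^{\min}_j,\tau^{\max}_j]$ for $j\in\mathcal J^{\mathrm{ac}}$; $p^{\mathrm{fr}}_{jt},p^{\mathrm{to}}_{jt}\in[-p^{\max}_j,p^{\max}_j]$, $q^{\mathrm{fr}}_{jt}\in[q^{\mathrm{fr,min}}_j,q^{\mathrm{fr,max}}_j]$, $q^{\mathrm{to}}_{jt}\in[q^{\mathrm{to,min}}_j,q^{\mathrm{to,max}}_j]$ for $j\in\mathcal J^{\mathrm{dc}}$; the voltage and tap bounds are positive. (F4) $u^{\mathrm{sh}}_{jt}\in[u^{\mathrm{sh,min}}_j,u^{\mathrm{sh,max}}_j]\cap\mathbb Z_+$ for $j\in\mathcal J^{\mathrm{sh}}$, with integral bounds. **Objective terms.** $C^{\mathrm{uc}}_j(u)=\sum_{t}\big(c^{\mathrm{on}}_{jt}u^{\mathrm{on}}_{jt}+c^{\mathrm{su}}_ju^{\mathrm{su}}_{jt}+c^{\mathrm{sd}}_ju^{\mathrm{sd}}_{jt}-\sum_{t'<t}c^{\mathrm{dd}}_{jtt'}[u^{\mathrm{su}}_{jt}+u^{\mathrm{on}}_{jt'}-1]^+\big)$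 with $c^{\mathrm{su}}_j,c^{\mathrm{sd}}_j,c^{\mathrm{dd}}_{jtt'}\ge0$. $C^{\mathrm e}_j(p)=c^{\mathrm e}\big(\sum_{W\in\mathcal W^{\mathrm{en,min}}_j}[e^{\min}_j(W)-\sum_{t\in W}d_tp^{\mathrm{tot}}_{jt}]^++\sum_{W\in\mathcal W^{\mathrm{en,max}}_j}[-e^{\max}_j(W)+\sum_{t\in W}d_tp^{\mathrm{tot}}_{jt}]^+\big)$, $c^{\mathrm e}\ge0$, where $\mathcal W^{\mathrm{en,min}}_j,\mathcal W^{\mathrm{en,max}}_j$ are finite families of subsets of $\mathcal T$. $C^{\mathrm{pow}}_{jt}$ ($j\in\mathcal J^{\mathrm{pr}}$) is a convex and $R^{\mathrm{pow}}_{jt}$ ($j\in\mathcal J^{\mathrm{cs}}$) a concave piecewise linear function of $p^{\mathrm{tot}}_{jt}$. $C^{\mathrm{res}}_t(p,q)=d_t\Big(\sum_{j,r}c^{\mathrm{res,p}}_{jtr}p^{\mathrm{res}}_{jtr}+\sum_{R'\subset\mathcal R}c^{\mathrm{res}}_{R'}\sum_{N\in\mathcal N^{\mathrm p}}\big[p^{\mathrm{res,min}}_t(p;R',N)-\sum_{r\in R'}\sum_{j\in N}p^{\mathrm{res}}_{jtr}\big]^++\sum_{r\in\{\uparrow,\downarrow\}}\big(\sum_jc^{\mathrm{res,q}}_{jtr}q^{\mathrm{res}}_{jtr}+c^{\mathrm{res}}_r\sum_{N\in\mathcal N^{\mathrm q}}[q^{\mathrm{res,min}}_t(q;r,N)-\sum_{j\in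 N}q^{\mathrm{res}}_{jtr}]^+\big)\Big)$, where $\mathcal N^{\mathrm p},\mathcal N^{\mathrm q}$ are finite families of subsets of $\mathcal J^{\mathrm{sd}}$, the coefficients $c^{\mathrm{res}}$ are nonnegative, and each requirement function is a constant, or a nonnegative multiple of the sum or of the maximum over $j\in N$ of the period-$t$ injections. $C^{\mathrm{ac}}_{jt}(p,q)=c^{\mathrm s}d_t\big[\max\{\|(p^{\mathrm{fr}}_{jt},q^{\mathrm{fr}}_{jt})\|_2,\|(p^{\mathrm{to}}_{jt},q^{\mathrm{to}}_{jt})\|_2\}-s^{\max}_j\big]^+$, $c^{\mathrm s}\ge0$. $C^{\mathrm{bal}}_{it}(p,q)=d_t(c^{\mathrm p}|B_{it}(p)|+c^{\mathrm q}|B_{it}(q)|)$, $c^{\mathrm p},c^{\mathrm q}\ge0$, where for $x\in\{p,q\}$, $B_{it}(x)=\sum_{j\in\mathcal J^{\mathrm{pr}},i_j=i}x^{\mathrm{tot}}_{jt}-\sum_{j\in\mathcal J^{\mathrm{cs}},i_j=i}x^{\mathrm{tot}}_{jt}-\sum_{j\in\mathcal J^{\mathrm{sh}},i_j=i}x^{\mathrm{sh}}_{jt}-\sum_{j\in\mathcal J^{\mathrm{br}},i_j=i}x^{\mathrm{fr}}_{jt}-\sum_{j\in\mathcal J^{\mathrm{br}},i'_j=i}x^{\mathrm{to}}_{jt}$. $C^{\mathrm{ctg}}_t=\frac1K\sum_{k=1}^KC^{\mathrm{ctg}}_{kt}+\max_kC^{\mathrm{ctg}}_{kt}$, $C^{\mathrm{ctg}}_{kt}(p,q)=c^{\mathrm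 s}d_t\sum_{j\in\mathcal J^{\mathrm{ac}},j\ne j_k}\big[\|(f_{kjt}(p),\max\{|q^{\mathrm{fr}}_{jt}|,|q^{\mathrm{to}}_{jt}|\})\|_2-s^{\mathrm{max,ctg}}_j\big]^+$, $f_{kjt}(p)=\sum_{i\in\mathcal I}F_{kji}\big(p^{\mathrm{inj}}_{it}(p)-\frac1{|\mathcal I|}\sum_{i'\in\mathcal I}p^{\mathrm{inj}}_{i't}(p)\big)$ with real data $F_{kji}$, $j_k\in\mathcal J^{\mathrm{ac}}$, and $p^{\mathrm{inj}}_{it}(p)$ equal to $B_{it}(p)$ with the sums over $\mathcal J^{\mathrm{br}}$ restricted to $\mathcal J^{\mathrm{dc}}$. $R^{\mathrm T}_t=-C^{\mathrm{res}}_t-C^{\mathrm{ctg}}_t-\sum_{j\in\mathcal J^{\mathrm{ac}}}C^{\mathrm{ac}}_{jt}-\sum_{i\in\mathcal I}C^{\mathrm{bal}}_{it}$. $R^{\mathrm J}_j=-C^{\mathrm{uc}}_j-C^{\mathrm e}_j+\sum_tR^{\mathrm{pow}}_{jt}$ if $j\in\mathcal J^{\mathrm{cs}}$, and $R^{\mathrm J}_j=-C^{\mathrm{uc}}_j-C^{\mathrm e}_j-\sum_tC^{\mathrm{pow}}_{jt}$ if $j\in\mathcal J^{\mathrm{pr}}$. **Standing assumption.** (1) $c^{\mathrm{su}}_j\ge\sum_{t'<t}c^{\mathrm{dd}}_{jtt'}$ for all $j,t$. (2) For each $j\in\mathcal J^{\mathrm{sd}}$, every $u_j$ satisfying (U)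 satisfies (S): $u^{\mathrm{on}}_{jt}+\sum_{t'\in\mathcal T^{\mathrm{supc}}_{jt}}u^{\mathrm{su}}_{jt'}\le1$ and $u^{\mathrm{on}}_{jt}+\sum_{t'\in\mathcal T^{\mathrm{sdpc}}_{jt}}u^{\mathrm{sd}}_{jt'}\le1$ for all $t$. (3) The sets $\mathcal X^{\mathrm p}_{jt}$ are closed, convex, bounded and polyhedral. (4) The problem of maximizing $\sum_tR^{\mathrm T}_t(p,q)+\sum_{j\in\mathcal J^{\mathrm{sd}}}R^{\mathrm J}_j(p,u)$ subject to (U), (P1)–(P4), (Q), (R), (F1)–(F4) is feasible with nonnegative optimal value. **Sets.** $\mathcal X^{\mathrm{uc}}_j=\{(p_j,q_j,u_j):\text{(U),(P1)–(P4),(Q),(R) for device }j\}$; $\mathcal X^{\mathrm{ac}}_t=\{(p_t,q_t,u^{\mathrm{sh}}_t):\exists(v_t,\Delta_t,\theta_t,\tau_t,\phi_t)\text{ with (F1)–(F3) at }t\}$; $\mathcal X^{\mathrm{sh}}_{jt}=\{u^{\mathrm{sh}}_{jt}:\text{(F4)}\}$; $\mathcal Y^{\mathrm{sh}}_{jt}=[u^{\mathrm{sh,min}}_j,u^{\mathrm{sh,max}}_j]$; $\mathcal Y^{\mathrm{uc}}_{jt}$ is the set of $(p_{jt},q_{jt},u^{\mathrm{on}}_{jt})$ with $u^{\mathrm{on}}_{jt}\ge0$ for which there exist $(u^{\mathrm{su}}_j,u^{\mathrm{sd}}_j)\in[0,1]^{2T}$ satisfying at $(j,t)$ the constraints (P1),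 (P3), (P4), (Q), (S) and $0\le p^{\mathrm{su}}_{jt}\le\sum_{t'\in\mathcal T^{\mathrm{supc}}_{jt}}p^{\mathrm{supc}}_{jtt'}u^{\mathrm{su}}_{jt'}$, $0\le p^{\mathrm{sd}}_{jt}\le\sum_{t'\in\mathcal T^{\mathrm{sdpc}}_{jt}}p^{\mathrm{sdpc}}_{jtt'}u^{\mathrm{sd}}_{jt'}$. **Problem COPY.** The copied variables are $w=(p^{\mathrm{tot}},p^{\mathrm{su}},p^{\mathrm{sd}},q^{\mathrm{tot}},q^{\mathrm{res}},u^{\mathrm{on}},u^{\mathrm{sh}})$; the overlined block $(\overline p,\overline q,\overline u)$ consists of device variables and $\overline u^{\mathrm{sh}}$. COPY: maximize $\sum_tR^{\mathrm T}_t(p_t,q_t)+\sum_{j\in\mathcal J^{\mathrm{sd}}}R^{\mathrm J}_j(\overline p_j,\overline u_j)$ subject to $(p_t,q_t,u^{\mathrm{sh}}_t)\in\mathcal X^{\mathrm{ac}}_t$, $(p_{jt},q_{jt},u^{\mathrm{on}}_{jt})\in\mathcal Y^{\mathrm{uc}}_{jt}$, $u^{\mathrm{sh}}_{jt}\in\mathcal Y^{\mathrm{sh}}_{jt}$, $(\overline p_j,\overline q_j,\overline u_j)\in\mathcal X^{\mathrm{uc}}_j$, $\overline u^{\mathrm{sh}}_{jt}\in\mathcal X^{\mathrm{sh}}_{jt}$ (for all relevant $j,t$) and $w=\overline w$. **Partial optimum.** A point $(p^*,q^*,u^*,\overline p^*,\overline q^*,\overline u^* )$ feasible for COPY that is globally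 optimal for COPY with the additional constraint $(p,q,u)=(p^*,q^*,u^* )$ and also globally optimal for COPY with the additional constraint $(\overline p,\overline q,\overline u)=(\overline p^*,\overline q^*,\overline u^* )$. **Penalties and subproblems.** For $\ell\in\{1,2\}$, $\Gamma_\ell(p,q,u,\overline p,\overline q,\overline u)=\|w-\overline w\|_\ell^\ell$; $\Gamma'_\ell$ is the same with the $u^{\mathrm{sh}}$ entries dropped; with subscripted arguments only the corresponding entries are used. $Z^{\mathrm T}_t(\overline p_t,\overline q_t,\overline u_t;\rho)$: maximize $R^{\mathrm T}_t(p_t,q_t)-\rho\Gamma_2(p_t,q_t,u_t,\overline p_t,\overline q_t,\overline u_t)$ over $(p_t,q_t,u^{\mathrm{sh}}_t)\in\mathcal X^{\mathrm{ac}}_t$, $(p_{jt},q_{jt},u^{\mathrm{on}}_{jt})\in\mathcal Y^{\mathrm{uc}}_{jt}$ ($j\in\mathcal J^{\mathrm{sd}}$), $u^{\mathrm{sh}}_{jt}\in\mathcal Y^{\mathrm{sh}}_{jt}$ ($j\in\mathcal J^{\mathrm{sh}}$). $Z^{\mathrm J}_j(p_j,q_j,u_j;\rho)$: maximize $R^{\mathrm J}_j(\overline p_j,\overline u_j)-\rho\Gamma'_1(p_j,q_j,u_j,\overline p_j,\overline q_j,\overline u_j)$ over $(\overline p_j,\overline q_j,\overline u_j)\in\mathcal X^{\mathrm{uc}}_j$. $Z^{\mathrm{SH}}_{jt}(u^{\mathrm{sh}}_{jt})=\lfloor\frac12+\mathrm{proj}_{[u^{\mathrm{sh,min}}_j,u^{\mathrm{sh,max}}_j]}(u^{\mathrm{sh}}_{jt})\rfloor$.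 **Basic penalty alternating direction method.** For $\tau=1,\dots,\overline\tau$ (all $\tau\ge1$ if $\overline\tau=\infty$): (i) for each $t$, solve $Z^{\mathrm T}_t(0,0,0;0)$ if $\tau=1$, and $Z^{\mathrm T}_t(\overline p^{(\tau-1)}_t,\overline q^{(\tau-1)}_t,\overline u^{(\tau-1)}_t;\rho_\tau)$ if $\tau>1$, obtaining $(p^{(\tau)}_t,q^{(\tau)}_t,u^{(\tau)}_t)$; (ii) for each $j\in\mathcal J^{\mathrm{sd}}$ solve $Z^{\mathrm J}_j(p^{(\tau)}_j,q^{(\tau)}_j,u^{(\tau)}_j;\rho_\tau)$, obtaining $(\overline p^{(\tau)}_j,\overline q^{(\tau)}_j,\overline u^{(\tau)}_j)$; (iii) set $\overline u^{\mathrm{sh}(\tau)}_{jt}=Z^{\mathrm{SH}}_{jt}(u^{\mathrm{sh}(\tau)}_{jt})$ for $j\in\mathcal J^{\mathrm{sh}}$, $t\in\mathcal T$.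
   Formalization: The integral shunt bounds u^{sh,min}, u^{sh,max} are taken to be nonnegative integers; with a negative lower bound the rounding Z^SH can return a negative step outside Z_+, and the limit point can then be infeasible for COPY. *)

(* Defs.v *)
From mathcomp Require Import all_boot all_order all_algebra.
From mathcomp Require Import all_classical all_reals all_analysis.

Set Implicit Arguments.
Unset Strict Implicit.
Unset Printing Implicit Defensive.

Import Order.TTheory GRing.Theory Num.Theory.
Import numFieldNormedType.Exports.

Local Open Scope classical_set_scope.
Local Open Scope ring_scope.

Section generic.
Context {R : realType}.

Definition pos_part (x : R) : R := Num.max x 0.

Definition norm2 (x y : R) : R := Num.sqrt (x ^+ 2 + y ^+ 2).

(* The genuine maximum of f over A when A is nonempty; 0 when A is empty. *)
Definition fin_max (I : finType) (A : {set I}) (f : I -> R) : R :=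
  if [pick i in A] is Some i0 then \big[Num.max/f i0]_(i in A) f i else 0.

(* Coordinates are indexed by an arbitrary finite type. *)
Definition polyhedral (I : finType) (S : set (I -> R)) : Prop :=
  exists (m : nat) (a : 'I_m -> I -> R) (b : 'I_m -> R),
    S = [set x | forall k, \sum_i a k i * x i <= b k].

Definition coord_bounded (I : finType) (S : set (I -> R)) : Prop :=
  exists M : R, forall x, S x -> forall i, `|x i| <= M.

(* s lists the breakpoints; using closed intervals makes f continuous. *)
Definition piecewise_linear (f : R -> R) : Prop :=
  exists s : seq R, forall x y, x <= y ->
    (forall c, c \in s -> ~~ (x < c < y)) ->
    exists a b, forall z, x <= z <= y -> f z = a * z + b.

Definition convex_pwl (f : R -> R) : Prop :=
  piecewise_linear f /\ @convex_function R R^o setT f.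

Definition concave_pwl (f : R -> R) : Prop :=
  piecewise_linear f /\ @convex_function R R^o setT (fun x => - f x).

Definition is_argmax (P : Type) (S : set P) (f : P -> R) (x : P) : Prop :=
  S x /\ forall y, S y -> f y <= f x.

Inductive reserve_requirement : Type :=
  | ReqConst of R
  | ReqSum of R
  | ReqMax of R.

Definition requirement_ok (q : reserve_requirement) : Prop :=
  match q with
  | ReqConst _ => True
  | ReqSum a => 0 <= a
  | ReqMax a => 0 <= a
  end.

Definition requirement_value (J : finType) (q : reserve_requirement)
    (N : {set J}) (x : J -> R) : R :=
  match q with
  | ReqConst a => a
  | ReqSum a => a * \sum_(j in N) x j
  | ReqMax a => a * fin_max N x
  end.

End generic.

Arguments reserve_requirement : clear implicits.

Record index_sets : Type := IndexSets {
  nT : nat;               (* the periods 1, ..., T are the elements of 'I_nT *)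
  nT_gt0 : (0 < nT)%N;
  Jpr : finType;
  Jcs : finType;
  Bus : finType;
  Jac : finType;
  Jdc : finType;
  Jsh : finType;
  Res : finType;
  nK : nat;               (* contingency k is the outage of the AC branch out k *)
  nK_gt0 : (0 < nK)%N
}.

Definition Jsd (X : index_sets) : finType := (Jpr X + Jcs X)%type.
Definition Jbr (X : index_sets) : finType := (Jac X + Jdc X)%type.

(* Directions of reactive reserve: true is "up", false is "down". *)
Definition q_up : bool := true.
Definition q_down : bool := false.

Record instance (R : realType) (X : index_sets) : Type := Instance {
  dur : 'I_(nT X) -> R;
  dur_gt0 : forall t, 0 < dur t;

  bus_sd : Jsd X -> Bus X;
  bus_sh : Jsh X -> Bus X;
  bus_fr : Jbr X -> Bus X;
  bus_to : Jbr X -> Bus X;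

  uon0 : Jsd X -> bool;
  ptot0 : Jsd X -> R;
  psupc : Jsd X -> 'I_(nT X) -> 'I_(nT X) -> R;
  psupc_ge0 : forall j t t', 0 <= psupc j t t';
  psdpc : Jsd X -> 'I_(nT X) -> 'I_(nT X) -> R;
  psdpc_ge0 : forall j t t', 0 <= psdpc j t t';
  (* coordinates: see u_coord and p_coord below *)
  polyU : Jsd X -> set ('I_3 * 'I_(nT X) -> R);
  polyU_polyhedral : forall j, polyhedral (polyU j);
  polyP : Jsd X -> 'I_(nT X) -> set ('I_3 + Res X -> R);
  polyP_polyhedral : forall j t, polyhedral (polyP j t);
  qmax : Jsd X -> 'I_(nT X) -> R;
  qmin : Jsd X -> 'I_(nT X) -> R;
  beta_max : Jsd X -> R;
  beta_min : Jsd X -> R;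
  ramp_up : Jsd X -> R;
  ramp_down : Jsd X -> R;
  ramp_up_su : Jsd X -> R;
  ramp_down_sd : Jsd X -> R;

  (* gbus i j, bbus i j: coefficients of branch j at its end bus i *)
  gbus : Bus X -> Jac X -> R;
  bbus : Bus X -> Jac X -> R;
  gser : Jac X -> R;
  bser : Jac X -> R;
  gsh : Jsh X -> R;
  bsh : Jsh X -> R;
  vmin : Bus X -> R;
  vmax : Bus X -> R;
  vmin_gt0 : forall i, 0 < vmin i;
  vmax_gt0 : forall i, 0 < vmax i;
  phimin : Jac X -> R;
  phimax : Jac X -> R;
  taumin : Jac X -> R;
  taumax : Jac X -> R;
  taumin_gt0 : forall j, 0 < taumin j;
  taumax_gt0 : forall j, 0 < taumax j;
  pdc_max : Jdc X -> R;
  qfr_min : Jdc X -> R;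
  qfr_max : Jdc X -> R;
  qto_min : Jdc X -> R;
  qto_max : Jdc X -> R;
  (* the bounds of the nonnegative integer step variables are themselves
     nonnegative integers *)
  ush_min : Jsh X -> nat;
  ush_max : Jsh X -> nat;

  con : Jsd X -> 'I_(nT X) -> R;
  csu : Jsd X -> R;
  csu_ge0 : forall j, 0 <= csu j;
  csd : Jsd X -> R;
  csd_ge0 : forall j, 0 <= csd j;
  cdd : Jsd X -> 'I_(nT X) -> 'I_(nT X) -> R;
  cdd_ge0 : forall j t t', 0 <= cdd j t t';
  cen : R;
  cen_ge0 : 0 <= cen;
  Wmin : Jsd X -> {set {set 'I_(nT X)}};
  Wmax : Jsd X -> {set {set 'I_(nT X)}};
  emin : Jsd X -> {set 'I_(nT X)} -> R;
  emax : Jsd X -> {set 'I_(nT X)} -> R;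
  Cpow : Jpr X -> 'I_(nT X) -> R -> R;
  Cpow_convex : forall j t, convex_pwl (Cpow j t);
  Rpow : Jcs X -> 'I_(nT X) -> R -> R;
  Rpow_concave : forall j t, concave_pwl (Rpow j t);

  cres_p : Jsd X -> 'I_(nT X) -> Res X -> R;
  cres_p_ge0 : forall j t r, 0 <= cres_p j t r;
  cres_pshort : {set Res X} -> R;
  cres_pshort_ge0 : forall R', 0 <= cres_pshort R';
  cres_q : Jsd X -> 'I_(nT X) -> bool -> R;
  cres_q_ge0 : forall j t r, 0 <= cres_q j t r;
  cres_qshort : bool -> R;
  cres_qshort_ge0 : forall r, 0 <= cres_qshort r;
  Np : {set {set Jsd X}};
  Nq : {set {set Jsd X}};
  preq : 'I_(nT X) -> {set Res X} -> {set Jsd X} -> reserve_requirement R;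
  preq_ok : forall t R' N, requirement_ok (preq t R' N);
  qreq : 'I_(nT X) -> bool -> {set Jsd X} -> reserve_requirement R;
  qreq_ok : forall t r N, requirement_ok (qreq t r N);

  cs : R;
  cs_ge0 : 0 <= cs;
  smax : Jac X -> R;
  cp : R;
  cp_ge0 : 0 <= cp;
  cq : R;
  cq_ge0 : 0 <= cq;
  out : 'I_(nK X) -> Jac X;
  smax_ctg : Jac X -> R;
  Fctg : 'I_(nK X) -> Jac X -> Bus X -> R
}.

Section problem.
Context {R : realType} {X : index_sets} (D : instance R X).
Local Notation time := 'I_(nT X).

(* Variables with subscript jt, for a device j. *)
Record dev_jt : Type := DevJT {
  ptot : R; pon : R; psu : R; psd : R; pres : Res X -> R;
  qtot : R; qres : bool -> R;
  uon : R
}.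

(* (p_t, q_t, u_t) *)
Record net_t : Type := NetT {
  dv : Jsd X -> dev_jt;
  pfr : Jbr X -> R; pto : Jbr X -> R; qfr : Jbr X -> R; qto : Jbr X -> R;
  psh : Jsh X -> R; qsh : Jsh X -> R;
  ush : Jsh X -> R
}.

(* (p_j, q_j, u_j), for a device j, start-up and shut-down included. *)
Record dev_j : Type := DevJ {
  at_t : time -> dev_jt;
  usu : time -> R;
  usd : time -> R
}.

Definition is_producer (j : Jsd X) : bool := if j is inl _ then true else false.

(* x0 is the value at the period preceding the first one. *)
Definition prev (x0 : R) (x : time -> R) (t : time) : R :=
  if t == 0%N :> nat then x0 else x (ord_pred t).

Definition Tsupc (j : Jsd X) (t : time) : {set time} :=
  [set t' : time | (t < t')%N && (0 < psupc D j t t')].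
Definition Tsdpc (j : Jsd X) (t : time) : {set time} :=
  [set t' : time | (t' <= t)%N && (0 < psdpc D j t t')].

Definition u_coord (on su sd : time -> R) : 'I_3 * time -> R :=
  fun i => [:: on i.2; su i.2; sd i.2]`_i.1.

Definition p_coord (d : dev_jt) : 'I_3 + Res X -> R :=
  fun i => match i with
           | inl k => [:: uon d; ptot d; pon d]`_k
           | inr r => pres d r
           end.

Definition binary (x : R) : Prop := x = 0 \/ x = 1.

Definition con_U (j : Jsd X) (on su sd : time -> R) : Prop :=
  [/\ forall t, on t - prev (uon0 D j)%:R on t = su t - sd t,
      forall t, su t + sd t <= 1,
      polyU D j (u_coord on su sd) &
      forall t, [/\ binary (on t), binary (su t) & binary (sd t)]].

Definition con_S (j : Jsd X) (t : time) (on : R) (su sd : time -> R) : Prop :=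
  on + \sum_(t' in Tsupc j t) su t' <= 1 /\
  on + \sum_(t' in Tsdpc j t) sd t' <= 1.

Definition su_power (j : Jsd X) (t : time) (su : time -> R) : R :=
  \sum_(t' in Tsupc j t) psupc D j t t' * su t'.
Definition sd_power (j : Jsd X) (t : time) (sd : time -> R) : R :=
  \sum_(t' in Tsdpc j t) psdpc D j t t' * sd t'.

Definition con_P1 (d : dev_jt) : Prop := ptot d = pon d + psu d + psd d.
Definition con_P2 (j : Jsd X) (t : time) (d : dev_jt) (su sd : time -> R) :
    Prop :=
  psu d = su_power j t su /\ psd d = sd_power j t sd.
Definition con_P3 (j : Jsd X) (t : time) (d : dev_jt) : Prop :=
  polyP D j t (p_coord d).
Definition con_P4 (d : dev_jt) : Prop :=
  [/\ 0 <= ptot d, 0 <= pon d & forall r, 0 <= pres d r].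

Definition con_Q (j : Jsd X) (t : time) (d : dev_jt) (su sd : time -> R) :
    Prop :=
  let sigma := uon d + \sum_(t' in Tsupc j t) su t'
                     + \sum_(t' in Tsdpc j t) sd t' in
  let a := if is_producer j then q_up else q_down in
  let b := if is_producer j then q_down else q_up in
  [/\ qtot d <= qmax D j t * sigma + beta_max D j * ptot d - qres d a,
      qmin D j t * sigma + beta_min D j * ptot d + qres d b <= qtot d &
      forall r, 0 <= qres d r].

Definition con_R (j : Jsd X) (t : time) (y : dev_j) : Prop :=
  let on := uon (at_t y t) in
  let p t' := ptot (at_t y t') in
  - (dur D t * (ramp_down D j * on + ramp_down_sd D j * (1 - on)))
    <= p t - prev (ptot0 D j) p t
    <= dur D t * (ramp_up D j * (on - usu y t)
                  + ramp_up_su D j * (usu y t - on + 1)).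

Definition Xuc (j : Jsd X) : set dev_j :=
  [set y | con_U j (fun t => uon (at_t y t)) (usu y) (usd y) /\
           forall t, [/\ con_P1 (at_t y t),
                         con_P2 j t (at_t y t) (usu y) (usd y),
                         con_P3 j t (at_t y t) & con_P4 (at_t y t)] /\
                     con_Q j t (at_t y t) (usu y) (usd y) /\
                     con_R j t y].

Definition Yuc (j : Jsd X) (t : time) : set dev_jt :=
  [set d | 0 <= uon d /\
    exists su sd : time -> R,
      [/\ forall t', 0 <= su t' <= 1,
          forall t', 0 <= sd t' <= 1,
          [/\ con_P1 d, con_P3 j t d & con_P4 d],
          con_Q j t d su sd /\ con_S j t (uon d) su sd &
          0 <= psu d <= su_power j t su /\ 0 <= psd d <= sd_power j t sd]].

(* The network data being constant over time, Xac, Xsh and Ysh carry no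
   period. *)
Definition con_F1 (x : net_t) (v theta : Bus X -> R)
    (Delta tau phi : Jac X -> R) (j : Jac X) : Prop :=
  let i := bus_fr D (inl j) in
  let i' := bus_to D (inl j) in
  let g := gser D j in let b := bser D j in
  let c := cos (Delta j) in let s := sin (Delta j) in
  [/\ Delta j = theta i - theta i' - phi j,
      pfr x (inl j) =
        v i * (gbus D i j * v i / tau j ^+ 2
               + v i' / tau j * (- g * c - b * s)),
      pto x (inl j) =
        v i' * (gbus D i' j * v i' + v i / tau j * (- g * c + b * s)),
      qfr x (inl j) =
        v i * (- bbus D i j * v i / tau j ^+ 2
               + v i' / tau j * (b * c - g * s)) &
      qto x (inl j) =
        v i' * (- bbus D i' j * v i' + v i / tau j * (b * c + g * s))].

Definition con_F2 (x : net_t) (v : Bus X -> R) : Prop :=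
  [/\ forall j : Jdc X, pfr x (inr j) + pto x (inr j) = 0,
      forall j, psh x j = gsh D j * ush x j * v (bus_sh D j) ^+ 2 &
      forall j, qsh x j = - bsh D j * ush x j * v (bus_sh D j) ^+ 2].

Definition con_F3 (x : net_t) (v : Bus X -> R) (tau phi : Jac X -> R) : Prop :=
  [/\ forall i, vmin D i <= v i <= vmax D i,
      forall j, phimin D j <= phi j <= phimax D j,
      forall j, taumin D j <= tau j <= taumax D j &
      forall j : Jdc X,
        [/\ - pdc_max D j <= pfr x (inr j) <= pdc_max D j,
            - pdc_max D j <= pto x (inr j) <= pdc_max D j,
            qfr_min D j <= qfr x (inr j) <= qfr_max D j &
            qto_min D j <= qto x (inr j) <= qto_max D j]].

Definition Xac : set net_t :=
  [set x | exists v theta Delta tau phi,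
    [/\ forall j, con_F1 x v theta Delta tau phi j,
        con_F2 x v & con_F3 x v tau phi]].

Definition Ysh (j : Jsh X) : set R :=
  [set u | (ush_min D j)%:R <= u <= (ush_max D j)%:R].
Definition Xsh (j : Jsh X) : set R :=
  [set u | Ysh j u /\ exists n : nat, u = n%:R].

Definition Cuc (j : Jsd X) (y : dev_j) : R :=
  \sum_(t < nT X)
    (con D j t * uon (at_t y t) + csu D j * usu y t + csd D j * usd y t
     - \sum_(t' < nT X | (t' < t)%N)
         cdd D j t t' * pos_part (usu y t + uon (at_t y t') - 1)).

Definition energy (W : {set time}) (y : dev_j) : R :=
  \sum_(t in W) dur D t * ptot (at_t y t).

Definition Ce (j : Jsd X) (y : dev_j) : R :=
  cen D * (\sum_(W in Wmin D j) pos_part (emin D j W - energy W y)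
           + \sum_(W in Wmax D j) pos_part (- emax D j W + energy W y)).

Definition RJ (j : Jsd X) (y : dev_j) : R :=
  - Cuc j y - Ce j y +
  match j with
  | inl i => - \sum_t Cpow D i t (ptot (at_t y t))
  | inr i => \sum_t Rpow D i t (ptot (at_t y t))
  end.

Definition Cres (t : time) (x : net_t) : R :=
  dur D t *
  (\sum_j \sum_r cres_p D j t r * pres (dv x j) r
   + \sum_(R' : {set Res X}) cres_pshort D R' *
       \sum_(N in Np D)
         pos_part (requirement_value (preq D t R' N) N (fun j => ptot (dv x j))
                   - \sum_(r in R') \sum_(j in N) pres (dv x j) r)
   + \sum_(r : bool)
       (\sum_j cres_q D j t r * qres (dv x j) r
        + cres_qshort D r *
          \sum_(N in Nq D)
            pos_part (requirement_value (qreq D t r N) N (fun j => qtot (dv x j))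
                      - \sum_(j in N) qres (dv x j) r))).

Definition Cac (t : time) (j : Jac X) (x : net_t) : R :=
  cs D * dur D t *
  pos_part (Num.max (norm2 (pfr x (inl j)) (qfr x (inl j)))
                    (norm2 (pto x (inl j)) (qto x (inl j))) - smax D j).

(* Balance at bus i, counting only the branches selected by br. *)
Definition balance_on (br : pred (Jbr X)) (i : Bus X)
    (tot : Jsd X -> R) (sh : Jsh X -> R) (fr to : Jbr X -> R) : R :=
  \sum_(j : Jpr X | bus_sd D (inl j) == i) tot (inl j)
  - \sum_(j : Jcs X | bus_sd D (inr j) == i) tot (inr j)
  - \sum_(j | bus_sh D j == i) sh j
  - \sum_(j | br j && (bus_fr D j == i)) fr j
  - \sum_(j | br j && (bus_to D j == i)) to j.

Definition Bp (i : Bus X) (x : net_t) : R :=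
  balance_on xpredT i (fun j => ptot (dv x j)) (psh x) (pfr x) (pto x).
Definition Bq (i : Bus X) (x : net_t) : R :=
  balance_on xpredT i (fun j => qtot (dv x j)) (qsh x) (qfr x) (qto x).

Definition is_dc (j : Jbr X) : bool := if j is inr _ then true else false.
Definition pinj (i : Bus X) (x : net_t) : R :=
  balance_on is_dc i (fun j => ptot (dv x j)) (psh x) (pfr x) (pto x).

Definition Cbal (t : time) (i : Bus X) (x : net_t) : R :=
  dur D t * (cp D * `|Bp i x| + cq D * `|Bq i x|).

Definition flow_ctg (k : 'I_(nK X)) (j : Jac X) (x : net_t) : R :=
  \sum_i Fctg D k j i * (pinj i x - #|Bus X|%:R^-1 * \sum_i' pinj i' x).

Definition Cctg_k (t : time) (k : 'I_(nK X)) (x : net_t) : R :=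
  cs D * dur D t *
  \sum_(j | j != out D k)
    pos_part (norm2 (flow_ctg k j x)
                    (Num.max `|qfr x (inl j)| `|qto x (inl j)|)
              - smax_ctg D j).

Definition Cctg (t : time) (x : net_t) : R :=
  (nK X)%:R^-1 * \sum_k Cctg_k t k x
  + fin_max [set: 'I_(nK X)]%SET (fun k => Cctg_k t k x).

Definition RT (t : time) (x : net_t) : R :=
  - Cres t x - Cctg t x - \sum_j Cac t j x - \sum_i Cbal t i x.

(* The original problem.  Since the objective does not involve
   v, theta, Delta, tau and phi, these are projected out (see Xac). *)
Record orig_point : Type := OrigPoint {
  o_net : time -> net_t;
  o_usu : Jsd X -> time -> R;
  o_usd : Jsd X -> time -> R
}.

Definition o_dev (o : orig_point) (j : Jsd X) : dev_j :=
  DevJ (fun t => dv (o_net o t) j) (o_usu o j) (o_usd o j).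

Definition orig_feasible : set orig_point :=
  [set o | [/\ forall t, Xac (o_net o t),
               forall j, Xuc j (o_dev o j) &
               forall j t, Xsh j (ush (o_net o t) j)]].

Definition orig_objective (o : orig_point) : R :=
  \sum_t RT t (o_net o t) + \sum_j RJ j (o_dev o j).

(* Closedness and convexity of polyP are part of polyP_polyhedral. *)
Record standing_assumption : Prop := StandingAssumption {
  sa_csu : forall j (t : time),
    \sum_(t' < nT X | (t' < t)%N) cdd D j t t' <= csu D j;
  sa_S : forall j (on su sd : time -> R), con_U j on su sd ->
    forall t, con_S j t (on t) su sd;
  sa_bounded : forall j t, coord_bounded (polyP D j t);
  sa_feasible : orig_feasible !=set0;
  sa_value : (0 <= ereal_sup [set (orig_objective o)%:E | o in orig_feasible])%E
}.

(* The overlined variables of the copy problem. *)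
Record bar_block : Type := BarBlock {
  bdev : Jsd X -> dev_j;
  bush : Jsh X -> time -> R
}.

Definition copy_point : Type := ((time -> net_t) * bar_block)%type.

(* The device entries of w at (j,t); pon and pres are not copied. *)
Definition w_coord (d : dev_jt) : 'I_5 + bool -> R :=
  fun i => match i with
           | inl k => [:: ptot d; psu d; psd d; qtot d; uon d]`_k
           | inr r => qres d r
           end.

Definition ZT_feasible (t : time) : set net_t :=
  [set x | [/\ Xac x, forall j, Yuc j t (dv x j) & forall j, Ysh j (ush x j)]].

Definition copy_feasible : set copy_point :=
  [set z | [/\ forall t, ZT_feasible t (z.1 t),
               forall j, Xuc j (bdev z.2 j),
               forall j t, Xsh j (bush z.2 j t),
               forall j t, w_coord (dv (z.1 t) j) =1 w_coord (at_t (bdev z.2 j) t) &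
               forall j t, ush (z.1 t) j = bush z.2 j t]].

Definition copy_objective (z : copy_point) : R :=
  \sum_t RT t (z.1 t) + \sum_j RJ j (bdev z.2 j).

Definition partial_optimum (z : copy_point) : Prop :=
  [/\ copy_feasible z,
      is_argmax (copy_feasible `&` [set z' | z'.1 = z.1]) copy_objective z &
      is_argmax (copy_feasible `&` [set z' | z'.2 = z.2]) copy_objective z].

(* Entries of the l-th power of the l-norm of w minus its copy. *)
Definition gamma_dev (l : nat) (d d' : dev_jt) : R :=
  \sum_i `|w_coord d i - w_coord d' i| ^+ l.

(* The slice at one period of the overlined block. *)
Record bar_t : Type := BarT {
  bdv_t : Jsd X -> dev_jt;
  bush_t : Jsh X -> R
}.

Definition bar_slice (y : bar_block) (t : time) : bar_t :=
  BarT (fun j => at_t (bdev y j) t) (fun j => bush y j t).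

Definition zero_dev : dev_jt :=
  DevJT 0 0 0 0 (fun=> 0) 0 (fun=> 0) 0.
Definition zero_bar_t : bar_t := BarT (fun=> zero_dev) (fun=> 0).

Definition Gamma_t (l : nat) (x : net_t) (y : bar_t) : R :=
  \sum_j gamma_dev l (dv x j) (bdv_t y j) + \sum_j `|ush x j - bush_t y j| ^+ l.

Definition Gamma'_j (l : nat) (x : time -> dev_jt) (y : dev_j) : R :=
  \sum_t gamma_dev l (x t) (at_t y t).

Definition solves_ZT (t : time) (y : bar_t) (rho : R) (x : net_t) : Prop :=
  is_argmax (ZT_feasible t) (fun x => RT t x - rho * Gamma_t 2 x y) x.

Definition solves_ZJ (j : Jsd X) (x : time -> dev_jt) (rho : R) (y : dev_j) :
    Prop :=
  is_argmax (Xuc j) (fun y => RJ j y - rho * Gamma'_j 1 x y) y.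

Definition ZSH (j : Jsh X) (u : R) : R :=
  (Num.floor (2^-1 + Num.max (ush_min D j)%:R
                       (Num.min u (ush_max D j)%:R)))%:~R.

(* z n is the n-th iterate for n >= 1; z 0 and rho 0 are irrelevant. *)
Definition padm_iterates (rho : nat -> R) (z : nat -> copy_point) : Prop :=
  forall n, (1 <= n)%N ->
    [/\ forall t, if n == 1%N
                  then solves_ZT t zero_bar_t 0 ((z n).1 t)
                  else solves_ZT t (bar_slice (z n.-1).2 t) (rho n) ((z n).1 t),
        forall j, solves_ZJ j (fun t => dv ((z n).1 t) j) (rho n)
                    (bdev (z n).2 j) &
        forall j t, bush (z n).2 j t = ZSH j (ush ((z n).1 t) j)].

Definition cvg_dev_jt (d : nat -> dev_jt) (d' : dev_jt) : Prop :=
  [/\ ptot (d n) @[n --> \oo] --> ptot d',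
      pon (d n) @[n --> \oo] --> pon d',
      psu (d n) @[n --> \oo] --> psu d',
      psd (d n) @[n --> \oo] --> psd d' &
      forall r, pres (d n) r @[n --> \oo] --> pres d' r] /\
  [/\ qtot (d n) @[n --> \oo] --> qtot d',
      forall r, qres (d n) r @[n --> \oo] --> qres d' r &
      uon (d n) @[n --> \oo] --> uon d'].

Definition cvg_net_t (x : nat -> net_t) (x' : net_t) : Prop :=
  [/\ forall j, cvg_dev_jt (fun n => dv (x n) j) (dv x' j),
      forall j, [/\ pfr (x n) j @[n --> \oo] --> pfr x' j,
                    pto (x n) j @[n --> \oo] --> pto x' j,
                    qfr (x n) j @[n --> \oo] --> qfr x' j &
                    qto (x n) j @[n --> \oo] --> qto x' j] &
      forall j, [/\ psh (x n) j @[n --> \oo] --> psh x' j,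
                    qsh (x n) j @[n --> \oo] --> qsh x' j &
                    ush (x n) j @[n --> \oo] --> ush x' j]].

Definition cvg_dev_j (y : nat -> dev_j) (y' : dev_j) : Prop :=
  forall t, [/\ cvg_dev_jt (fun n => at_t (y n) t) (at_t y' t),
                usu (y n) t @[n --> \oo] --> usu y' t &
                usd (y n) t @[n --> \oo] --> usd y' t].

Definition cvg_copy_point (z : nat -> copy_point) (z' : copy_point) : Prop :=
  [/\ forall t, cvg_net_t (fun n => (z n).1 t) (z'.1 t),
      forall j, cvg_dev_j (fun n => bdev (z n).2 j) (bdev z'.2 j) &
      forall j t, bush (z n).2 j t @[n --> \oo] --> bush z'.2 j t].

(* There being finitely many real coordinates, limit points are the limits of
   coordinatewise convergent subsequences. *)
Definition seq_limit_point (z : nat -> copy_point) (z' : copy_point) : Prop :=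
  exists2 s : nat -> nat,
    {homo s : m n / (m < n)%N} & cvg_copy_point (fun n => z (s n)) z'.

End problem.

Arguments dev_jt : clear implicits.
Arguments net_t : clear implicits.
Arguments dev_j : clear implicits.
Arguments bar_block : clear implicits.
Arguments copy_point : clear implicits.

(* Main.v *)
Require Import Defs.
From mathcomp Require Import all_boot all_order all_algebra.
From mathcomp Require Import all_classical all_reals all_analysis.
From mathcomp Require Import ring lra zify.
Import Order.TTheory GRing.Theory Num.Theory.
Import numFieldNormedType.Exports.
Local Open Scope classical_set_scope.
Local Open Scope ring_scope.

Set Implicit Arguments.
Unset Strict Implicit.
Unset Printing Implicit Defensive.

(* Limits are taken along an ultrafilter F on the indices n of a convergent
   subsequence: every bounded sequence then has a limit, so that the previous
   device block yp_n, on which the n-th network block x_n depends, converges as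
   well, without further extraction.

   The network can match any feasible device block exactly (its device variables
   are feasible for the period subproblems by (S), and only the shunt consumption
   depends on the shunt steps). Comparing x_n with such a matching point gives
   rho_n Gamma_2(x_n, yp_n) <= O(1), hence w(x_n) - w(yp_n) -> 0; comparing y_n
   with yp_n then gives w(x_n) - w(y_n) -> 0, and rounding leaves the shunt steps
   unchanged. So the limit point satisfies w = wbar.

   The limit is optimal in the barred block because w determines the objective of
   a device. It is optimal in the unbarred block because a competitor x' differs
   from the limit of yp_n, as far as devices are concerned, only in the reserves
   pres; replacing pres(yp_n) by pres(yp_n) + lam (pres(x') - pres(lim yp_n)) with
   lam < 1 yields, by polyhedrality, points that are eventually feasible for the
   period subproblem and match yp_n exactly; finally lam -> 1. *)

(** * Limits of real functions along filters and ultrafilters *)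

Section limits.
Context {R : realType} {T : Type} {F : set_system T}.

Section filter.
Context {FF : Filter F}.

Lemma cvg_sum (I : Type) (r : seq I) (P : pred I) (f : I -> T -> R) (l : I -> R) :
  (forall i, P i -> f i x @[x --> F] --> l i) ->
  \sum_(i <- r | P i) f i x @[x --> F] --> \sum_(i <- r | P i) l i.
Proof. by apply: cvg_big; exact: add_continuous. Qed.

Lemma cvg_maxr (f g : T -> R) (a b : R) : f @ F --> a -> g @ F --> b ->
  Num.max (f x) (g x) @[x --> F] --> Num.max a b.
Proof.
move=> fa gb; under eq_fun do rewrite maxr_absE; rewrite maxr_absE.
apply: cvgMr_tmp; apply: cvgD; first exact: cvgD.
by apply: cvg_norm; exact: cvgB.
Qed.

Lemma cvg_pos_part (f : T -> R) (a : R) : f @ F --> a ->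
  pos_part (f x) @[x --> F] --> pos_part a.
Proof. by move=> fa; apply: cvg_maxr => //; exact: cvg_cst. Qed.

Lemma cvg_sqr (f : T -> R) (a : R) : f @ F --> a -> f x ^+ 2 @[x --> F] --> a ^+ 2.
Proof.
by move=> fa; rewrite expr2; under eq_fun do rewrite expr2; exact: cvgM.
Qed.

Lemma cvg_norm2 (f g : T -> R) (a b : R) : f @ F --> a -> g @ F --> b ->
  norm2 (f x) (g x) @[x --> F] --> norm2 a b.
Proof.
move=> fa gb; rewrite /norm2.
apply: (@continuous_cvg _ _ _ _ _ (fun x => f x ^+ 2 + g x ^+ 2) Num.sqrt).
  exact: sqrt_continuous.
by apply: cvgD; exact: cvg_sqr.
Qed.

Lemma cvg_bigmax (I : Type) (r : seq I) (P : pred I) (f : T -> I -> R)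
    (l : I -> R) (f0 : T -> R) (l0 : R) :
  f0 @ F --> l0 -> (forall i, f x i @[x --> F] --> l i) ->
  \big[Num.max/f0 x]_(i <- r | P i) f x i @[x --> F]
    --> \big[Num.max/l0]_(i <- r | P i) l i.
Proof.
move=> fl0 fl; elim: r => [|i r IHr].
  by under eq_fun do rewrite big_nil; rewrite big_nil.
under eq_fun do rewrite big_cons; rewrite big_cons.
by case: ifP => // _; exact: cvg_maxr.
Qed.

Lemma cvg_fin_max (I : finType) (A : {set I}) (f : T -> I -> R) (l : I -> R) :
  (forall i, f x i @[x --> F] --> l i) ->
  fin_max A (f x) @[x --> F] --> fin_max A l.
Proof.
move=> fl; rewrite /fin_max; case: pickP => [i0 _|_]; last exact: cvg_cst.
exact: cvg_bigmax.
Qed.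

Lemma cvg_requirement_value (J : finType) (q : reserve_requirement R)
    (N : {set J}) (f : T -> J -> R) (l : J -> R) :
  (forall j, f x j @[x --> F] --> l j) ->
  requirement_value q N (f x) @[x --> F] --> requirement_value q N l.
Proof.
move=> fl; case: q => [a|a|a] /=; first exact: cvg_cst.
  by apply: cvgMl_tmp; exact: cvg_sum.
by apply: cvgMl_tmp; exact: cvg_fin_max.
Qed.

(* A constraint active at the limit [l] is preserved by the shift, an inactive
   one stays inactive because [lam < 1]. *)
Lemma near_shift_le (u : T -> R) (l b c lam : R) :
  u @ F --> l -> (\near F, u F <= b) -> l <= b -> c <= b -> 0 <= lam < 1 ->
  \forall x \near F, u x + lam * (c - l) <= b.
Proof.
move=> ul ub lb cb /andP[lam0 lam1].
have [lb'|] := boolP (l < b); last first.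
  rewrite -leNgt => bl; have -> : l = b by apply/eqP; rewrite eq_le lb.
  by apply: filterS ub => x xb; nra.
have lc : l < b - lam * (c - l) by nra.
by apply: filterS (cvgr_le _ ul _ lc) => x xb; rewrite -lerBrDr.
Qed.

(** Finitely many inequalities define [S], so the eventual validity of each one, given by
    [near_shift_le], is an eventual validity of all. *)
Lemma polyhedral_shift (I : finType) (S : set (I -> R)) (u : T -> I -> R)
    (l b : I -> R) (lam : R) : polyhedral S ->
  (forall i, u x i @[x --> F] --> l i) -> (\forall x \near F, S (u x)) ->
  S l -> S b -> 0 <= lam < 1 ->
  \forall x \near F, S (fun i => u x i + lam * (b i - l i)).
Proof.
move=> [m [a [c ->]]] ul Su Sl Sb lam01; apply: filter_forall => k.
have cu : \sum_i a k i * u x i @[x --> F] --> \sum_i a k i * l i.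
  by apply: cvg_sum => i _; exact: cvgMl_tmp.
have nu : \forall x \near F, \sum_i a k i * u x i <= c k.
  by apply: filterS Su => x; exact.
apply: filterS (near_shift_le cu nu (Sl k) (Sb k) lam01) => x; congr (_ <= _).
rewrite -sumrB mulr_sumr -big_split /=; apply: eq_bigr => i _; lra.
Qed.

(** Two integers closer than 1/2 to [l] differ by less than 1, hence coincide; so [u] is eventually
    constant and its limit is that constant. *)
Lemma cvg_int_near (u : T -> R) (l : R) : u @ F --> l ->
  (\forall x \near F, u x \is a Num.int) -> ProperFilter F ->
  \forall x \near F, u x = l.
Proof.
move=> ul uint PF.
have H : \forall x \near F, `|l - u x| < 2^-1 /\ u x \is a Num.int.
  have ul2 : \forall x \near F, `|l - u x| < 2^-1 by apply: cvgr_dist_lt => //; lra.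
  by apply: filterS2 ul2 uint => x; split.
have [x0 [x0l x0i]] := filter_ex H.
have {}H : \forall x \near F, u x = u x0.
  apply: filterS H => x [xl xi]; apply/eqP; rewrite -subr_eq0.
  have : u x - u x0 \is a Num.int by rewrite rpredB.
  move=> /intrP[k Ek]; rewrite Ek intr_eq0.
  have : `|k%:~R : R| < 1.
    rewrite -Ek; have -> : u x - u x0 = (l - u x0) - (l - u x) by lra.
    by apply: le_lt_trans (ler_normB _ _) _; lra.
  by rewrite -intr_norm (_ : 1 = 1%:~R) // ltr_int; lia.
have -> : l = u x0.
  apply: (cvg_unique _ ul); first exact: norm_hausdorff.
  by apply: cvg_near_cst.
exact: H.
Qed.

End filter.

(** Compactness of [[a, b]] gives a cluster point, which is a limit because an ultrafilter contains
    every set or its complement. *)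
Lemma ultra_cvg {FU : UltraFilter F} (u : T -> R) (a b : R) :
  (forall x, a <= u x <= b) -> exists l : R, u @ F --> l.
Proof.
move=> uab; have PF : ProperFilter F := ultra_proper.
have uF : (u @ F) `[a, b]%classic.
  by apply: (@filterS _ F _ setT) => [x _ /=|]; [rewrite in_itv /=|exact: filterT].
have [l [_ lcl]] := @segment_compact R a b (u @ F) _ uF.
exists l => A Al; have [//|FnA] := in_ultra_setVsetC (u @^-1` A) FU.
by have [y []] := lcl (~` A) A FnA Al.
Qed.

Lemma ultra_squeeze {FU : UltraFilter F} (u v w : T -> R) (a b : R) :
  u @ F --> a -> v @ F --> b -> (forall x, u x <= w x <= v x) ->
  exists l : R, w @ F --> l.
Proof.
move=> ua vb uwv; have PF : ProperFilter F := ultra_proper.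
(* The bounds [u] and [v] vary, so [w] is truncated to fixed ones; the margin 1 makes the truncation
   eventually inactive. *)
have [|l wl] := @ultra_cvg FU
  (fun x => Num.max (a - 1) (Num.min (w x) (b + 1))) (a - 1) (Num.max (a - 1) (b + 1)).
  move=> x; rewrite le_max lexx /= ge_max le_max lexx /=.
  by rewrite le_max [X in _ || X]ge_min lexx !orbT.
exists l; apply: cvg_trans wl; apply: near_eq_cvg.
have ua1 : \forall x \near F, a - 1 <= u x by apply: cvgr_ge ua _ _; lra.
have vb1 : \forall x \near F, v x <= b + 1 by apply: cvgr_le vb _ _; lra.
apply: filterS2 ua1 vb1 => x xa xb; have /andP[uw wv] := uwv x.
by rewrite (min_idPl (le_trans wv xb)) (max_idPr (le_trans xa uw)).
Qed.

End limits.

(** * Coordinatewise convergence and continuity of the objective terms *)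

Section convergence.
Context {R : realType} {X : index_sets} {T : Type} (F : set_system T).

(** Counterpart of [cvg_dev_jt] for an arbitrary filter; [net_cvg] and [devj_cvg] extend it in the
    same way. *)
Record dev_cvg (d : T -> dev_jt R X) (d' : dev_jt R X) : Prop := DevCvg {
  ptot_cvg : ptot (d x) @[x --> F] --> ptot d';
  pon_cvg : pon (d x) @[x --> F] --> pon d';
  psu_cvg : psu (d x) @[x --> F] --> psu d';
  psd_cvg : psd (d x) @[x --> F] --> psd d';
  pres_cvg : forall r, pres (d x) r @[x --> F] --> pres d' r;
  qtot_cvg : qtot (d x) @[x --> F] --> qtot d';
  qres_cvg : forall r, qres (d x) r @[x --> F] --> qres d' r;
  uon_cvg : uon (d x) @[x --> F] --> uon d'
}.

Record net_cvg (z : T -> net_t R X) (z' : net_t R X) : Prop := NetCvg {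
  dv_cvg : forall j, dev_cvg (fun x => dv (z x) j) (dv z' j);
  pfr_cvg : forall j, pfr (z x) j @[x --> F] --> pfr z' j;
  pto_cvg : forall j, pto (z x) j @[x --> F] --> pto z' j;
  qfr_cvg : forall j, qfr (z x) j @[x --> F] --> qfr z' j;
  qto_cvg : forall j, qto (z x) j @[x --> F] --> qto z' j;
  psh_cvg : forall j, psh (z x) j @[x --> F] --> psh z' j;
  qsh_cvg : forall j, qsh (z x) j @[x --> F] --> qsh z' j;
  ush_cvg : forall j, ush (z x) j @[x --> F] --> ush z' j
}.

Record devj_cvg (y : T -> dev_j R X) (y' : dev_j R X) : Prop := DevjCvg {
  at_cvg : forall t, dev_cvg (fun x => at_t (y x) t) (at_t y' t);
  usu_cvg : forall t, usu (y x) t @[x --> F] --> usu y' t;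
  usd_cvg : forall t, usd (y x) t @[x --> F] --> usd y' t
}.

Context {FF : Filter F} (D : instance R X).

Lemma p_coord_cvg d d' i : dev_cvg d d' -> p_coord (d x) i @[x --> F] --> p_coord d' i.
Proof.
by case=> ? ? ? ? ? ? ? ?; case: i => [[[|[|[|k]]] ltk]|r] /=.
Qed.

Lemma w_coord_cvg d d' i : dev_cvg d d' -> w_coord (d x) i @[x --> F] --> w_coord d' i.
Proof.
by case=> ? ? ? ? ? ? ? ?; case: i => [[[|[|[|[|[|k]]]]] ltk]|r] /=.
Qed.

Lemma balance_on_cvg (br : pred (Jbr X)) i
    (tot : T -> Jsd X -> R) (sh : T -> Jsh X -> R) (fr to : T -> Jbr X -> R)
    tot' sh' fr' to' :
  (forall j, tot x j @[x --> F] --> tot' j) ->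
  (forall j, sh x j @[x --> F] --> sh' j) ->
  (forall j, fr x j @[x --> F] --> fr' j) ->
  (forall j, to x j @[x --> F] --> to' j) ->
  balance_on D br i (tot x) (sh x) (fr x) (to x) @[x --> F]
    --> balance_on D br i tot' sh' fr' to'.
Proof.
by move=> ? ? ? ?; do 4?apply: cvgB; apply: cvg_sum.
Qed.

Section net.
Variables (z : T -> net_t R X) (z' : net_t R X) (zz' : net_cvg z z').

Lemma Cres_cvg t : Cres D t (z x) @[x --> F] --> Cres D t z'.
Proof.
have zp j := ptot_cvg (dv_cvg zz' j); have zq j := qtot_cvg (dv_cvg zz' j).
have zr j := pres_cvg (dv_cvg zz' j); have zs j := qres_cvg (dv_cvg zz' j).
apply: cvgMl_tmp; apply: cvgD; first apply: cvgD.
- by apply: cvg_sum => j _; apply: cvg_sum => r _; exact: cvgMl_tmp.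
- apply: cvg_sum => R' _; apply: cvgMl_tmp; apply: cvg_sum => N _.
  apply: cvg_pos_part; apply: cvgB; first exact: cvg_requirement_value.
  by apply: cvg_sum => r _; apply: cvg_sum => j _.
- apply: cvg_sum => r _; apply: cvgD.
    by apply: cvg_sum => j _; exact: cvgMl_tmp.
  apply: cvgMl_tmp; apply: cvg_sum => N _.
  apply: cvg_pos_part; apply: cvgB; first exact: cvg_requirement_value.
  by apply: cvg_sum => j _.
Qed.

Lemma Cac_cvg t j : Cac D t j (z x) @[x --> F] --> Cac D t j z'.
Proof.
have [_ ? ? ? ? _ _ _] := zz'.
apply: cvgMl_tmp; apply: cvg_pos_part; apply: cvgB; last exact: cvg_cst.
by apply: cvg_maxr; apply: cvg_norm2.
Qed.

Lemma Cbal_cvg t i : Cbal D t i (z x) @[x --> F] --> Cbal D t i z'.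
Proof.
have zp j := ptot_cvg (dv_cvg zz' j); have zq j := qtot_cvg (dv_cvg zz' j).
have [_ ? ? ? ? ? ? _] := zz'.
by apply: cvgMl_tmp; apply: cvgD; apply: cvgMl_tmp; apply: cvg_norm;
  exact: balance_on_cvg.
Qed.

Lemma pinj_cvg i : pinj D i (z x) @[x --> F] --> pinj D i z'.
Proof.
have zp j := ptot_cvg (dv_cvg zz' j).
by have [_ ? ? ? ? ? ? _] := zz'; exact: balance_on_cvg.
Qed.

Lemma Cctg_k_cvg t k : Cctg_k D t k (z x) @[x --> F] --> Cctg_k D t k z'.
Proof.
have [_ _ _ ? ? _ _ _] := zz'.
apply: cvgMl_tmp; apply: cvg_sum => j _; apply: cvg_pos_part.
apply: cvgB; last exact: cvg_cst.
apply: cvg_norm2; last by apply: cvg_maxr; exact: cvg_norm.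
apply: cvg_sum => i _; apply: cvgMl_tmp; apply: cvgB; first exact: pinj_cvg.
by apply: cvgMl_tmp; apply: cvg_sum => i' _; exact: pinj_cvg.
Qed.

Lemma RT_cvg t : RT D t (z x) @[x --> F] --> RT D t z'.
Proof.
apply: cvgB; first apply: cvgB; first apply: cvgB.
- by apply: cvgN; exact: Cres_cvg.
- apply: cvgD; last by apply: cvg_fin_max => k; exact: Cctg_k_cvg.
  by apply: cvgMl_tmp; apply: cvg_sum => k _; exact: Cctg_k_cvg.
- by apply: cvg_sum => j _; exact: Cac_cvg.
- by apply: cvg_sum => i _; exact: Cbal_cvg.
Qed.

End net.

Section devj.
Variables (y : T -> dev_j R X) (y' : dev_j R X) (yy' : devj_cvg y y').

Lemma Cuc_cvg j : Cuc D j (y x) @[x --> F] --> Cuc D j y'.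
Proof.
have yu t := uon_cvg (at_cvg yy' t); have [_ ? ?] := yy'.
apply: cvg_sum => t _; apply: cvgB.
  by do 2?apply: cvgD; exact: cvgMl_tmp.
apply: cvg_sum => t' _; apply: cvgMl_tmp; apply: cvg_pos_part.
by apply: cvgB; [exact: cvgD|exact: cvg_cst].
Qed.

Lemma Ce_cvg j : Ce D j (y x) @[x --> F] --> Ce D j y'.
Proof.
have yW W : energy D W (y x) @[x --> F] --> energy D W y'.
  by apply: cvg_sum => t _; apply: cvgMl_tmp; exact: ptot_cvg (at_cvg yy' t).
apply: cvgMl_tmp; apply: cvgD; apply: cvg_sum => W _; apply: cvg_pos_part.
  by apply: cvgB => //; exact: cvg_cst.
by apply: cvgD => //; exact: cvg_cst.
Qed.

Lemma su_power_cvg j t :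
  su_power D j t (usu (y x)) @[x --> F] --> su_power D j t (usu y').
Proof. by apply: cvg_sum => t' _; apply: cvgMl_tmp; exact: usu_cvg. Qed.

Lemma sd_power_cvg j t :
  sd_power D j t (usd (y x)) @[x --> F] --> sd_power D j t (usd y').
Proof. by apply: cvg_sum => t' _; apply: cvgMl_tmp; exact: usd_cvg. Qed.

End devj.

End convergence.

(** The chord over [[0, M]] bounds [f] from above; convexity at the midpoint of [x] and [M - x]
    turns this into a lower bound. *)
Lemma convex_bounded {R : realType} (f : R -> R) (M : R) :
  @convex_function R R^o setT f ->
  exists K : R, forall x, 0 <= x <= M -> `|f x| <= K.
Proof.
move=> cf; have {}cf t x y : 0 <= t <= 1 ->
    f (t * x + (1 - t) * y) <= t * f x + (1 - t) * f y.
  move=> /andP[t0 t1]; have := cf (Itv01 t0 t1) x y.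
  by rewrite !inE => /(_ I I); rewrite !convRE.
exists (`|f 0| + `|f M| + 2 * `|f (M / 2)|) => x /andP[x0 xM].
have f0 := ler_norm (f 0); have fM := ler_norm (f M).
have fM2 := lerNnormlW (lexx `|f (M / 2)|).
have ub z : 0 <= z <= M -> f z <= `|f 0| + `|f M|.
  move=> /andP[z0 zM]; have [M0|M0] := eqVneq M 0.
    have -> : z = 0 by lra.
    by rewrite M0; have := normr_ge0 (f 0); lra.
  have {}M0 : 0 < M by lra.
  have t01 : 0 <= z / M <= 1 by rewrite divr_ge0 ?ler_pdivrMr ?mul1r //; lra.
  have := cf (z / M) M 0 t01.
  rewrite mulr0 addr0 divfK ?gt_eqF // => /le_trans; apply.
  move: t01; set t := z / M; have := normr_ge0 (f 0); have := normr_ge0 (f M).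
  nra.
have h : f (M / 2) <= (f x + f (M - x)) / 2.
  have := cf 2^-1 x (M - x); have -> : 2^-1 * x + (1 - 2^-1) * (M - x) = M / 2 by lra.
  by move=> cfx; apply: le_trans (cfx _) _; lra.
have h1 : f (M - x) <= `|f 0| + `|f M| by apply: ub; lra.
have h2 : f x <= `|f 0| + `|f M| by apply: ub; lra.
have := normr_ge0 (f (M / 2)); rewrite ler_norml => *; apply/andP; split; lra.
Qed.

(** * Conditions preserved by limits *)

Section closed_conditions.
Context {R : realType} {T : Type} {F : set_system T} {PF : ProperFilter F}.

Lemma cvg_le2 (u v : T -> R) (a b : R) : u @ F --> a -> v @ F --> b ->
  (forall x, u x <= v x) -> a <= b.
Proof.
move=> ua vb uv; rewrite -subr_ge0; apply: (cvgr_to_ge (cvgB vb ua)).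
by apply: filterE => x; rewrite subr_ge0.
Qed.

Lemma cvg_eq2 (u v : T -> R) (a b : R) : u @ F --> a -> v @ F --> b ->
  (forall x, u x = v x) -> a = b.
Proof.
move=> ua vb uv; apply/eqP; rewrite eq_le; apply/andP; split.
  by apply: cvg_le2 ua vb _ => x; rewrite uv.
by apply: cvg_le2 vb ua _ => x; rewrite uv.
Qed.

Lemma cvg_ge_cst (u : T -> R) (l a : R) : u @ F --> l ->
  (forall x, a <= u x) -> a <= l.
Proof. by move=> ul au; apply: cvgr_to_ge ul _; exact: filterE. Qed.

Lemma cvg_le_cst (u : T -> R) (l a : R) : u @ F --> l ->
  (forall x, u x <= a) -> l <= a.
Proof. by move=> ul ua; apply: cvgr_to_le ul _; exact: filterE. Qed.

Lemma cvg_itv (u : T -> R) (l a b : R) : u @ F --> l ->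
  (forall x, a <= u x <= b) -> a <= l <= b.
Proof.
move=> ul uab; apply/andP; split.
  by apply: cvg_ge_cst ul _ => x; case/andP: (uab x).
by apply: cvg_le_cst ul _ => x; case/andP: (uab x).
Qed.

Lemma polyhedral_closed (I : finType) (S : set (I -> R)) (u : T -> I -> R)
    (l : I -> R) : polyhedral S -> (forall i, u x i @[x --> F] --> l i) ->
  (forall x, S (u x)) -> S l.
Proof.
move=> [m [a [c ->]]] ul Su k.
apply: (@cvg_le_cst (fun x => \sum_i a k i * u x i)) => [|x]; last exact: (Su x k).
by apply: cvg_sum => i _; exact: cvgMl_tmp.
Qed.

(** A convergent integer-valued function eventually equals its limit, so the limit is one of the
    values taken. *)
Lemma binary_closed (u : T -> R) (l : R) : u @ F --> l ->
  (forall x, binary (u x)) -> binary l.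
Proof.
move=> ul ub; have /filter_ex[x <-] : \forall x \near F, u x = l.
  apply: cvg_int_near => //; apply: filterE => x.
  by case: (ub x) => ->; rewrite ?rpred0 ?rpred1.
exact: ub.
Qed.

End closed_conditions.

Lemma periodicz (U V : zmodType) (f : U -> V) (a0 : U) : periodic f a0 ->
  forall (k : int) a, f (a + a0 *~ k) = f a.
Proof.
move=> fT [n|n] a; first exact: (periodicn fT n a).
by have := periodicn fT n.+1 (a - a0 *+ n.+1); rewrite subrK NegzE mulrNz => ->.
Qed.

(** * Closedness of the device constraints *)

Section device_closed.
Context {R : realType} {X : index_sets} (D : instance R X).

Section closed.
Context {T : Type} {F : set_system T} {PF : ProperFilter F}.

Lemma prev_cvg (x0 : R) (f : T -> 'I_(nT X) -> R) f' t :
  (forall t, f x t @[x --> F] --> f' t) ->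
  Defs.prev x0 (f x) t @[x --> F] --> Defs.prev x0 f' t.
Proof. by move=> ff'; rewrite /Defs.prev; case: ifP => // _; exact: cvg_cst. Qed.

Lemma con_P1_closed d (d' : dev_jt R X) : dev_cvg F d d' ->
  (forall x, con_P1 (d x)) -> con_P1 d'.
Proof.
case=> dp dn ds dd _ _ _ _ H; apply: (cvg_eq2 dp _ H).
by apply: cvgD => //; exact: cvgD.
Qed.

Lemma con_P3_closed j t d (d' : dev_jt R X) : dev_cvg F d d' ->
  (forall x, con_P3 D j t (d x)) -> con_P3 D j t d'.
Proof.
move=> dd' H; apply: (@polyhedral_closed _ _ F _ _ _ _ _ (polyP_polyhedral D j t) _ H) => i.
exact: p_coord_cvg.
Qed.

Lemma con_P4_closed d (d' : dev_jt R X) : dev_cvg F d d' ->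
  (forall x, con_P4 (d x)) -> con_P4 d'.
Proof.
case=> dp dn _ _ dr _ _ _ H; split=> [||r].
- by apply: (cvg_ge_cst dp) => x; case: (H x).
- by apply: (cvg_ge_cst dn) => x; case: (H x).
- by apply: (cvg_ge_cst (dr r)) => x; case: (H x).
Qed.

Lemma con_Q_closed j t d (d' : dev_jt R X) su su' sd sd' : dev_cvg F d d' ->
  (forall t, su x t @[x --> F] --> su' t) ->
  (forall t, sd x t @[x --> F] --> sd' t) ->
  (forall x, con_Q D j t (d x) (su x) (sd x)) -> con_Q D j t d' su' sd'.
Proof.
case=> dp _ _ _ _ dq dr du sus sds H.
have sig : uon (d x) + \sum_(t' in Tsupc D j t) su x t'
         + \sum_(t' in Tsdpc D j t) sd x t' @[x --> F] -->
         uon d' + \sum_(t' in Tsupc D j t) su' t'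
         + \sum_(t' in Tsdpc D j t) sd' t'.
  by apply: cvgD; [apply: cvgD => //|]; apply: cvg_sum.
split=> [||r].
- apply: (cvg_le2 dq) => [|x]; last by case: (H x) => h _ _; exact: h.
  by apply: cvgB => //; apply: cvgD; exact: cvgMl_tmp.
- apply: (cvg_le2 _ dq) => [|x]; last by case: (H x) => _ h _; exact: h.
  by apply: cvgD => //; apply: cvgD; exact: cvgMl_tmp.
- by apply: (cvg_ge_cst (dr r)) => x; case: (H x).
Qed.

Lemma Xuc_closed j y y' : devj_cvg F y y' -> (forall x, Xuc D j (y x)) ->
  Xuc D j y'.
Proof.
move=> yy' H; have [ya ysu ysd] := yy'.
have yu t := uon_cvg (ya t); have yp t := ptot_cvg (ya t).
split.
  split=> [t|t||t].
  - apply: (@cvg_eq2 _ _ F _ (fun x => uon (at_t (y x) t)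
        - Defs.prev (uon0 D j)%:R (fun t => uon (at_t (y x) t)) t)
        (fun x => usu (y x) t - usd (y x) t)).
    + by apply: cvgB => //; exact: (prev_cvg (f := fun x t => uon (at_t (y x) t)) yu).
    + exact: cvgB.
    + by move=> x; case: (H x) => -[].
  - apply: (cvg_le_cst (cvgD (ysu t) (ysd t))) => x.
    by case: (H x) => -[_ h _ _] _; exact: h.
  - have HU x := let: conj (And4 _ _ h _) _ := H x in h.
    apply: (@polyhedral_closed _ _ F _ _ _ _ _ (polyU_polyhedral D j) _ HU).
    by move=> [[[|[|[|k]]] ltk] t] //=; [exact: yu|exact: ysu|exact: ysd].
  - by split; [apply: (binary_closed (yu t))|apply: (binary_closed (ysu t))
      |apply: (binary_closed (ysd t))] => x; case: (H x) => -[_ _ _ /(_ t)[]].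
move=> t; have H2 x := (H x).2 t.
split; first split.
- by apply: (con_P1_closed (ya t)) => x; case: (H2 x) => -[].
- split.
    apply: (cvg_eq2 (psu_cvg (ya t)) (su_power_cvg yy' (j := j) (t := t))) => x.
    by case: (H2 x) => -[_ []].
  apply: (cvg_eq2 (psd_cvg (ya t)) (sd_power_cvg yy' (j := j) (t := t))) => x.
  by case: (H2 x) => -[_ []].
- by apply: (con_P3_closed (ya t)) => x; case: (H2 x) => -[].
- by apply: (con_P4_closed (ya t)) => x; case: (H2 x) => -[].
split.
  by apply: (con_Q_closed (ya t) ysu ysd) => x; case: (H2 x) => _ [].
have pp : ptot (at_t (y x) t) - Defs.prev (ptot0 D j) (fun t => ptot (at_t (y x) t)) t
    @[x --> F] --> ptot (at_t y' t) - Defs.prev (ptot0 D j) (fun t => ptot (at_t y' t)) t.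
  by apply: cvgB => //; exact: (prev_cvg (f := fun x t => ptot (at_t (y x) t)) yp).
apply/andP; split.
  apply: (cvg_le2 _ pp) => [|x]; last by case: (H2 x) => _ [_ /andP[h _]]; exact: h.
  apply: cvgN; apply: cvgMl_tmp; apply: cvgD; apply: cvgMl_tmp => //.
  by apply: cvgB => //; exact: cvg_cst.
apply: (cvg_le2 pp) => [|x]; last by case: (H2 x) => _ [_ /andP[_ h]]; exact: h.
apply: cvgMl_tmp; apply: cvgD; apply: cvgMl_tmp; first exact: cvgB.
by apply: cvgD; [exact: cvgB|exact: cvg_cst].
Qed.

End closed.
End device_closed.

(** * Feasible sets: normalization of angles and exchange of device blocks *)

Section feasible_sets.
Context {R : realType} {X : index_sets} (D : instance R X).

(* The phase angles can be taken modulo 2 pi, hence in a compact set. *)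
Lemma Xac_angles x : Xac D x -> exists v theta Delta tau phi,
  [/\ forall j, con_F1 D x v theta Delta tau phi j,
      con_F2 D x v, con_F3 D x v tau phi &
      forall i, 0 <= theta i <= pi *+ 2].
Proof.
move=> [v [theta [Delta [tau [phi [F1 F2 F3]]]]]].
have pi2 : 0 < (pi : R) *+ 2 by rewrite pmulrn_lgt0 // pi_gt0.
(* The floor counts the full turns to remove; [Delta] is shifted by the difference of turns at the
   two end buses, which preserves its defining equation. *)
pose k i := - Num.floor (theta i / (pi *+ 2)).
exists v, (fun i => theta i + (pi *+ 2) *~ k i),
  (fun j => Delta j + (pi *+ 2) *~ (k (bus_fr D (inl j)) - k (bus_to D (inl j)))),
  tau, phi; split=> // [j|i].
  have [FD Fpf Fpt Fqf Fqt] := F1 j.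
  split; rewrite ?(periodicz (@cosD2pi R)) ?(periodicz (@sinD2pi R)) //.
  by rewrite FD mulrzBr; ring.
rewrite /k mulrNz -mulrzr.
have := Num.Theory.floor_itv (theta i / (pi *+ 2)); set m := Num.floor _.
rewrite intrD ler_pdivlMr // ltr_pdivrMr // => /andP[].
set p := pi *+ 2 in pi2 *; nra.
Qed.

(* Only the shunt consumption depends on the shunt steps: any step positions
   and device variables are compatible with a given network state. *)
Definition swap_net (x : net_t R X) (v : Bus X -> R)
    (d : Jsd X -> dev_jt R X) (u : Jsh X -> R) : net_t R X :=
  NetT d (pfr x) (pto x) (qfr x) (qto x)
    (fun j => gsh D j * u j * v (bus_sh D j) ^+ 2)
    (fun j => - bsh D j * u j * v (bus_sh D j) ^+ 2) u.

Lemma Xac_swap x : Xac D x -> exists v : Bus X -> R,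
  [/\ forall j, psh x j = gsh D j * ush x j * v (bus_sh D j) ^+ 2,
      forall j, qsh x j = - bsh D j * ush x j * v (bus_sh D j) ^+ 2 &
      forall d u, Xac D (swap_net x v d u)].
Proof.
move=> [v [theta [Delta [tau [phi [F1 [F2 Fp Fq] F3]]]]]].
by exists v; split=> // d u; exists v, theta, Delta, tau, phi.
Qed.

(** Once [w_coord] is prescribed, (P1) fixes [pon], and the reserves [pres] are the only freedom
    left. *)
Definition with_pres (d : dev_jt R X) (p : Res X -> R) : dev_jt R X :=
  DevJT (ptot d) (pon d) (psu d) (psd d) p (qtot d) (qres d) (uon d).

(** The start-up and shut-down decisions of [y] are the witnesses: (S) comes from the standing
    assumption, and (P2) turns the upper bounds on [psu] and [psd] into equalities. *)
Lemma Xuc_Yuc j t y p : standing_assumption D -> Xuc D j y ->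
  Defs.polyP D j t (p_coord (with_pres (at_t y t) p)) -> (forall r, 0 <= p r) ->
  Yuc D j t (with_pres (at_t y t) p).
Proof.
move=> sa [HU /(_ t) [[H1 [H2 H2'] H3 [p1 p2 _]] [HQ _]]] Hp p0.
have [_ _ _ Hb] := HU; have {Hb} Hb t' : [/\ 0 <= uon (at_t y t') <= 1,
    0 <= usu y t' <= 1 & 0 <= usd y t' <= 1].
  have [[->|->] [->|->] [->|->]] := Hb t'; split; lra.
split; first by case: (Hb t) => /andP[].
exists (usu y), (usd y); split=> [t'|t'|||].
- by case: (Hb t').
- by case: (Hb t').
- by split.
- by split=> //; exact: sa_S sa _ _ _ _ HU t.
- rewrite /= H2 H2' !lexx !andbT; split; apply: sumr_ge0 => t' _.
    by rewrite mulr_ge0 ?psupc_ge0 //; case: (Hb t') => _ /andP[].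
  by rewrite mulr_ge0 ?psdpc_ge0 //; case: (Hb t') => _ _ /andP[].
Qed.

(** * Closedness and compactness along an ultrafilter *)

Section ultra.
Context {T : Type} {F : set_system T} {FU : UltraFilter F}.
Let PF : ProperFilter F := ultra_proper.
Existing Instance PF.

Lemma ultra_cvg_fun (I : Type) (u : T -> I -> R) (a b : I -> R) :
  (forall x i, a i <= u x i <= b i) ->
  exists l : I -> R, forall i, u x i @[x --> F] --> l i.
Proof.
move=> uab; have /choice[l ul] : forall i, exists l : R, u x i @[x --> F] --> l.
  by move=> i; apply: (@ultra_cvg _ _ F _ _ (a i) (b i)) => x; exact: uab.
by exists l.
Qed.

(** A hidden network state is chosen for each index; its coordinates are bounded, the angles thanks
    to [Xac_angles], so it converges, and its limit is the witness. *)
Lemma Xac_closed z z' : net_cvg F z z' -> (forall x, Xac D (z x)) -> Xac D z'.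
Proof.
move=> [_ zpf zpt zqf zqt zps zqs zu] H.
have /choice[v /choice[th /choice[De /choice[ta /choice[ph]]]]] :=
  fun x => Xac_angles (H x).
move=> {}H.
have [v' vv'] : exists l : Bus X -> R, forall i, v x i @[x --> F] --> l i.
  apply: (@ultra_cvg_fun _ _ (vmin D) (vmax D)) => x i.
  by case: (H x) => _ _ [h _ _ _] _; exact: h.
have [th' tth'] : exists l : Bus X -> R, forall i, th x i @[x --> F] --> l i.
  apply: (@ultra_cvg_fun _ _ (fun=> 0) (fun=> pi *+ 2)) => x i.
  by case: (H x) => _ _ _ h; exact: h.
have [ta' tta'] : exists l : Jac X -> R, forall i, ta x i @[x --> F] --> l i.
  apply: (@ultra_cvg_fun _ _ (taumin D) (taumax D)) => x i.
  by case: (H x) => _ _ [_ _ h _] _; exact: h.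
have [ph' pph'] : exists l : Jac X -> R, forall i, ph x i @[x --> F] --> l i.
  apply: (@ultra_cvg_fun _ _ (phimin D) (phimax D)) => x i.
  by case: (H x) => _ _ [_ h _ _] _; exact: h.
(* [Delta] has no bound of its own; its limit is read off from its defining equation. *)
pose De' j := th' (bus_fr D (inl j)) - th' (bus_to D (inl j)) - ph' j.
have DDe' j : De x j @[x --> F] --> De' j.
  have -> : (fun x => De x j) = fun x =>
      th x (bus_fr D (inl j)) - th x (bus_to D (inl j)) - ph x j.
    by apply: funext => x; case: (H x) => /(_ j)[].
  by apply: cvgB; [exact: cvgB|exact: pph'].
have cD j : cos (De x j) @[x --> F] --> cos (De' j).
  by apply: continuous_cvg => //; exact: continuous_cos.
have sD j : sin (De x j) @[x --> F] --> sin (De' j).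
  by apply: continuous_cvg => //; exact: continuous_sin.
(* A positive lower bound on the tap ratio lets the divisions in (F1) pass to the limit. *)
have ta0 j : ta' j != 0.
  rewrite gt_eqF // (lt_le_trans (taumin_gt0 D j)) //.
  apply: (cvg_ge_cst (tta' j)) => x.
  by case: (H x) => _ _ [_ _ h _] _; case/andP: (h j).
have tV j : (ta x j)^-1 @[x --> F] --> (ta' j)^-1 by exact: cvgV.
have tV2 j : (ta x j ^+ 2)^-1 @[x --> F] --> (ta' j ^+ 2)^-1.
  by apply: cvgV; [rewrite expf_neq0|exact: cvg_sqr].
have vsqr i : v x i ^+ 2 @[x --> F] --> v' i ^+ 2 by exact: cvg_sqr.
exists v', th', De', ta', ph'; split.
- move=> j; split=> //.
  + apply: (cvg_eq2 (zpf (inl j))) => [|x]; last first.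
      by case: (H x) => /(_ j)[_ h _ _ _] _ _ _; exact: h.
    apply: cvgM => //; apply: cvgD; first by apply: cvgM => //; exact: cvgMl_tmp.
    by apply: cvgM; [exact: cvgM|apply: cvgB; exact: cvgMl_tmp].
  + apply: (cvg_eq2 (zpt (inl j))) => [|x]; last first.
      by case: (H x) => /(_ j)[_ _ h _ _] _ _ _; exact: h.
    apply: cvgM => //; apply: cvgD; first exact: cvgMl_tmp.
    by apply: cvgM; [exact: cvgM|apply: cvgD; exact: cvgMl_tmp].
  + apply: (cvg_eq2 (zqf (inl j))) => [|x]; last first.
      by case: (H x) => /(_ j)[_ _ _ h _] _ _ _; exact: h.
    apply: cvgM => //; apply: cvgD; first by apply: cvgM => //; exact: cvgMl_tmp.
    by apply: cvgM; [exact: cvgM|apply: cvgB; exact: cvgMl_tmp].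
  + apply: (cvg_eq2 (zqt (inl j))) => [|x]; last first.
      by case: (H x) => /(_ j)[_ _ _ _ h] _ _ _; exact: h.
    apply: cvgM => //; apply: cvgD; first exact: cvgMl_tmp.
    by apply: cvgM; [exact: cvgM|apply: cvgD; exact: cvgMl_tmp].
- split=> j.
  + apply: (cvg_eq2 (cvgD (zpf (inr j)) (zpt (inr j))) (cvg_cst 0)) => x.
    by case: (H x) => _ [h _ _] _ _; exact: h.
  + apply: (cvg_eq2 (zps j)) => [|x]; last by case: (H x) => _ [_ h _] _ _; exact: h.
    by apply: cvgM => //; exact: cvgMl_tmp.
  + apply: (cvg_eq2 (zqs j)) => [|x]; last by case: (H x) => _ [_ _ h] _ _; exact: h.
    by apply: cvgM => //; exact: cvgMl_tmp.
- split=> [i|j|j|j].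
  + by apply: (cvg_itv (vv' i)) => x; case: (H x) => _ _ [h _ _ _] _; exact: h.
  + by apply: (cvg_itv (pph' j)) => x; case: (H x) => _ _ [_ h _ _] _; exact: h.
  + by apply: (cvg_itv (tta' j)) => x; case: (H x) => _ _ [_ _ h _] _; exact: h.
  + have h x := let: And4 _ _ (And4 _ _ _ h) _ := H x in h j.
    split; [apply: (cvg_itv (zpf _))|apply: (cvg_itv (zpt _))
      |apply: (cvg_itv (zqf _))|apply: (cvg_itv (zqt _))] => x;
      by case: (h x).
Qed.

(** The hidden start-up and shut-down fractions lie in [[0, 1]], so they have limits, which are the
    witnesses. *)
Lemma Yuc_closed j t d d' : dev_cvg F d d' -> (forall x, Yuc D j t (d x)) ->
  Yuc D j t d'.
Proof.
move=> dd' H; split.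
  by apply: (cvg_ge_cst (uon_cvg dd')) => x; case: (H x).
have /choice[su /choice[sd {}H]] := fun x => (H x).2.
have [su' sus] : exists l : 'I_(nT X) -> R, forall i, su x i @[x --> F] --> l i.
  by apply: (@ultra_cvg_fun _ _ (fun=> 0) (fun=> 1)) => x i; case: (H x).
have [sd' sds] : exists l : 'I_(nT X) -> R, forall i, sd x i @[x --> F] --> l i.
  by apply: (@ultra_cvg_fun _ _ (fun=> 0) (fun=> 1)) => x i; case: (H x).
have suP : su_power D j t (su x) @[x --> F] --> su_power D j t su'.
  by apply: cvg_sum => t' _; exact: cvgMl_tmp.
have sdP : sd_power D j t (sd x) @[x --> F] --> sd_power D j t sd'.
  by apply: cvg_sum => t' _; exact: cvgMl_tmp.
have [_ _ dsu dsd _ _ _ du] := dd'.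
exists su', sd'; split=> [t'|t'|||].
- by apply: (cvg_itv (sus t')) => x; case: (H x).
- by apply: (cvg_itv (sds t')) => x; case: (H x).
- split.
  + by apply: (con_P1_closed dd') => x; case: (H x) => _ _ [].
  + by apply: (con_P3_closed dd') => x; case: (H x) => _ _ [].
  + by apply: (con_P4_closed dd') => x; case: (H x) => _ _ [].
- split; first by apply: (con_Q_closed dd' sus sds) => x; case: (H x) => _ _ _ [].
  split.
    apply: (@cvg_le_cst _ _ F) => [|x]; last by case: (H x) => _ _ _ [_ [h _]] _; exact: h.
    by apply: cvgD => //; exact: cvg_sum.
  apply: (@cvg_le_cst _ _ F) => [|x]; last by case: (H x) => _ _ _ [_ [_ h]] _; exact: h.
  by apply: cvgD => //; exact: cvg_sum.
- have h x := let: And5 _ _ _ _ h := H x in h.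
  split; apply/andP; split.
  + by apply: (cvg_ge_cst dsu) => x; case: (h x) => /andP[].
  + by apply: (cvg_le2 dsu suP) => x; case: (h x) => /andP[].
  + by apply: (cvg_ge_cst dsd) => x; case: (h x) => _ /andP[].
  + by apply: (cvg_le2 dsd sdP) => x; case: (h x) => _ /andP[].
Qed.

(** Commitments are binary, [p_coord] is bounded by the standing assumption, (P2) determines [psu]
    and [psd], and (Q) traps the reactive quantities between convergent bounds. *)
Lemma Xuc_ultra_cvg j y : standing_assumption D -> (forall x, Xuc D j (y x)) ->
  exists y', devj_cvg F y y'.
Proof.
move=> sa H.
have Hb x t : [/\ 0 <= uon (at_t (y x) t) <= 1,
    0 <= usu (y x) t <= 1 & 0 <= usd (y x) t <= 1].
  case: (H x) => -[_ _ _ /(_ t)[b1 b2 b3]] _.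
  by have [[->|->] [->|->] [->|->]] := And3 b1 b2 b3; split; lra.
have [su' sus] : exists l : 'I_(nT X) -> R, forall i, usu (y x) i @[x --> F] --> l i.
  by apply: (@ultra_cvg_fun _ _ (fun=> 0) (fun=> 1)) => x i; case: (Hb x i).
have [sd' sds] : exists l : 'I_(nT X) -> R, forall i, usd (y x) i @[x --> F] --> l i.
  by apply: (@ultra_cvg_fun _ _ (fun=> 0) (fun=> 1)) => x i; case: (Hb x i).
suff /choice[d' dd'] : forall t, exists d', dev_cvg F (fun x => at_t (y x) t) d'.
  by exists (DevJ d' su' sd').
move=> t; have H2 x := (H x).2 t.
have [M HM] := sa_bounded sa j t.
have [pc pcc] : exists l : 'I_3 + Res X -> R,
    forall i, p_coord (at_t (y x) t) i @[x --> F] --> l i.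
  apply: (@ultra_cvg_fun _ _ (fun=> - M) (fun=> M)) => x i.
  by rewrite -ler_norml; apply: HM; case: (H2 x) => -[].
pose i0 : 'I_3 := Ordinal (isT : (0 < 3)%N).
pose i1 : 'I_3 := Ordinal (isT : (1 < 3)%N).
pose i2 : 'I_3 := Ordinal (isT : (2 < 3)%N).
have cu := pcc (inl i0); have cp := pcc (inl i1); have cn := pcc (inl i2).
pose sig x := uon (at_t (y x) t) + \sum_(t' in Tsupc D j t) usu (y x) t'
                     + \sum_(t' in Tsdpc D j t) usd (y x) t'.
pose sig' := pc (inl i0) + \sum_(t' in Tsupc D j t) su' t'
                     + \sum_(t' in Tsdpc D j t) sd' t'.
have sigc : sig x @[x --> F] --> sig'.
  by apply: cvgD; [apply: cvgD => //|]; apply: cvg_sum.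
pose A x := qmax D j t * sig x + beta_max D j * ptot (at_t (y x) t).
pose B x := qmin D j t * sig x + beta_min D j * ptot (at_t (y x) t).
have Ac : A x @[x --> F] --> qmax D j t * sig' + beta_max D j * pc (inl i1).
  by apply: cvgD; exact: cvgMl_tmp.
have Bc : B x @[x --> F] --> qmin D j t * sig' + beta_min D j * pc (inl i1).
  by apply: cvgD; exact: cvgMl_tmp.
(* Nonnegative reserves in (Q) give [B <= qtot <= A], and then each reserve is at most the gap
   [A - B]. *)
have AB x : [/\ B x <= qtot (at_t (y x) t) <= A x &
    forall r, 0 <= qres (at_t (y x) t) r <= A x - B x].
  have [_ [[]]] := H2 x; rewrite -/(sig x) -/(A x) -/(B x) => h1 h2 h3 _.
  have hu := h3 q_up; have hd := h3 q_down; move: h1 h2 hu hd.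
  rewrite /q_up /q_down; case: (is_producer j) => h1 h2 hu hd.
    by split=> [|[]]; lra.
  by split=> [|[]]; lra.
have [qt qtc] : exists l : R, qtot (at_t (y x) t) @[x --> F] --> l.
  by apply: (ultra_squeeze Bc Ac) => x; case: (AB x).
have /choice[qr qrc] : forall r, exists l : R,
    qres (at_t (y x) t) r @[x --> F] --> l.
  move=> r; apply: (ultra_squeeze (cvg_cst 0) (cvgB Ac Bc)) => x.
  by case: (AB x) => _ h; exact: h.
exists (DevJT (pc (inl i1)) (pc (inl i2)) (su_power D j t su')
  (sd_power D j t sd') (fun r => pc (inr r)) qt qr (pc (inl i0))).
split=> //=.
- have -> : (fun x => psu (at_t (y x) t)) = fun x => su_power D j t (usu (y x)).
    by apply: funext => x; case: (H2 x) => -[_ []].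
  by apply: cvg_sum => t' _; exact: cvgMl_tmp.
- have -> : (fun x => psd (at_t (y x) t)) = fun x => sd_power D j t (usd (y x)).
    by apply: funext => x; case: (H2 x) => -[_ []].
  by apply: cvg_sum => t' _; exact: cvgMl_tmp.
- by move=> r; exact: (pcc (inr r)).
Qed.

(** The penalty estimate asks for some limit of the values, not for its identification; the power
    terms get one from their boundedness on [[0, M]]. *)
Lemma RJ_ultra_cvg j y : standing_assumption D -> (forall x, Xuc D j (y x)) ->
  exists l : R, RJ D j (y x) @[x --> F] --> l.
Proof.
move=> sa H; have [y' yy'] := Xuc_ultra_cvg sa H.
have cc := cvgB (cvgN (Cuc_cvg yy' (D := D) (j := j))) (Ce_cvg yy' (D := D) (j := j)).
have pb t : exists M : R, forall x, 0 <= ptot (at_t (y x) t) <= M.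
  have [M HM] := sa_bounded sa j t; exists M => x.
  case: (H x) => _ /(_ t) [[_ _ h3 [h4 _ _]] _]; rewrite h4 /=.
  apply: le_trans (ler_norm _) _.
  exact: (HM _ h3 (inl (Ordinal (isT : (1 < 3)%N)))).
case: j H cc pb => j H cc pb.
  have /choice[l ll] : forall t, exists l : R,
      Cpow D j t (ptot (at_t (y x) t)) @[x --> F] --> l.
    move=> t; have [M HM] := pb t.
    have [K HK] := convex_bounded M (Cpow_convex D j t).2.
    by apply: (@ultra_cvg _ _ F _ _ (- K) K) => x; rewrite -ler_norml; exact: HK.
  exists (- Cuc D (inl j) y' - Ce D (inl j) y' + - \sum_t l t).
  by apply: cvgD; [exact: cc|apply: cvgN; exact: cvg_sum].
have /choice[l ll] : forall t, exists l : R,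
    Rpow D j t (ptot (at_t (y x) t)) @[x --> F] --> l.
  move=> t; have [M HM] := pb t.
  have [K HK] := convex_bounded M (Rpow_concave D j t).2.
  apply: (@ultra_cvg _ _ F _ _ (- K) K) => x; rewrite -ler_norml -normrN.
  exact: HK.
exists (- Cuc D (inr j) y' - Ce D (inr j) y' + \sum_t l t).
by apply: cvgD; [exact: cc|exact: cvg_sum].
Qed.

End ultra.
End feasible_sets.

(** Dividing by [r] bounds [g] by [c / r], which tends to 0. *)
Lemma penalty_limit_le0 {R : realType} {T : Type} {F : set_system T}
    {PF : ProperFilter F} (r g c : T -> R) (g0 c0 : R) :
  (forall x, 0 < r x) -> r @ F --> +oo -> g @ F --> g0 -> c @ F --> c0 ->
  (forall x, r x * g x <= c x) -> g0 <= 0.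
Proof.
move=> r0 ry gg cc rgc.
have rV : (r x)^-1 @[x --> F] --> 0.
  apply/cvgrVy; first by apply: filterE => x; rewrite invr_gt0.
  by apply: cvg_trans ry; apply: near_eq_cvg; apply: filterE => x; exact: esym (invrK _).
rewrite -(mulr0 c0); apply: (cvg_le2 gg (cvgM cc rV)) => x.
by rewrite ler_pdivlMr // mulrC.
Qed.

(** * Rounding, penalty terms and matching competitors *)

Section subproblems.
Context {R : realType} {X : index_sets} (D : instance R X).

(** Within the range the projection is the identity, and an error below 1/2 keeps [2^-1 + u] in
    [[k, k + 1)]. *)
Lemma ZSH_round j (u : R) (k : nat) : Xsh D j k%:R -> Ysh D j u ->
  `|k%:R - u| < 2^-1 -> ZSH D j u = k%:R.
Proof.
move=> [/andP[k1 k2] _] /andP[u1 u2]; rewrite ltr_norml => /andP[ku uk].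
rewrite /ZSH (min_idPl u2) (max_idPr u1) (@Num.Theory.floor_def _ _ k%:Z) //.
rewrite intrD -pmulrn; apply/andP; split; lra.
Qed.

(** The rounded value [m] satisfies [u - 1/2 < m <= u + 1/2]; since both bounds of the range are
    integers, it cannot leave the range. *)
Lemma Xsh_ZSH j (u : R) : Ysh D j u -> Xsh D j (ZSH D j u).
Proof.
move=> /andP[u1 u2]; rewrite /ZSH (min_idPl u2) (max_idPr u1).
have := Num.Theory.floor_itv (2^-1 + u); set m := Num.floor _ => /andP[m1 m2].
have am : ((ush_min D j)%:Z <= m)%R.
  rewrite -ltzD1 -(ltr_int R); apply: le_lt_trans m2.
  by rewrite -pmulrn; lra.
have mb : m <= (ush_max D j)%:Z.
  rewrite -ltzD1 -(ltr_int R); apply: le_lt_trans m1 _.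
  by rewrite intrD -pmulrn; lra.
split.
  by rewrite /Ysh /= !pmulrn !ler_int am mb.
by exists `|m|%N; rewrite pmulrn gez0_abs //; lia.
Qed.

Lemma gamma_dev_eq0 l (d d' : dev_jt R X) : (0 < l)%N ->
  gamma_dev l d d' <= 0 -> w_coord d =1 w_coord d'.
Proof.
move=> l0 g0 i; apply/eqP; rewrite -subr_eq0 -normr_eq0.
have h k : 0 <= `|w_coord d k - w_coord d' k| ^+ l by exact: exprn_ge0.
have : `|w_coord d i - w_coord d' i| ^+ l == 0.
  rewrite eq_le h andbT; rewrite /gamma_dev (bigD1 i) //= in g0.
  have := @sumr_ge0 R _ (index_enum _) (fun k => k != i) _ (fun k _ => h k).
  lra.
by rewrite expf_eq0 l0.
Qed.

Lemma gamma_dev_ge0 l (d d' : dev_jt R X) : 0 <= gamma_dev l d d'.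
Proof. by apply: sumr_ge0 => i _; exact: exprn_ge0. Qed.

Lemma eq_gamma_dev l (d d' : dev_jt R X) : (0 < l)%N ->
  w_coord d =1 w_coord d' -> gamma_dev l d d' = 0.
Proof.
move=> l0 dd'; apply: big1 => i _.
by rewrite dd' subrr normr0 expr0n gtn_eqF.
Qed.

Lemma Gamma_t_ge0 l x (y : @bar_t R X) : 0 <= Gamma_t l x y.
Proof.
apply: addr_ge0; apply: sumr_ge0 => j _; first exact: gamma_dev_ge0.
exact: exprn_ge0.
Qed.

Lemma Gamma_t_eq0 l x (y : @bar_t R X) : (0 < l)%N -> Gamma_t l x y <= 0 ->
  (forall j, w_coord (dv x j) =1 w_coord (bdv_t y j)) /\
  (forall j, ush x j = bush_t y j).
Proof.
move=> l0 G0.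
have h1 j : 0 <= gamma_dev l (dv x j) (bdv_t y j) by exact: gamma_dev_ge0.
have h2 j : 0 <= `|ush x j - bush_t y j| ^+ l by exact: exprn_ge0.
have s1 : 0 <= \sum_j gamma_dev l (dv x j) (bdv_t y j) by exact: sumr_ge0.
have s2 : 0 <= \sum_j `|ush x j - bush_t y j| ^+ l by exact: sumr_ge0.
move: G0; rewrite /Gamma_t => G0; split=> j.
  apply: (gamma_dev_eq0 l0).
  rewrite (bigD1 j) //= in G0.
  have := @sumr_ge0 R _ (index_enum (Jsd X)) (fun i => i != j) _ (fun i _ => h1 i).
  lra.
apply/eqP; rewrite -subr_eq0 -normr_eq0.
have : `|ush x j - bush_t y j| ^+ l == 0.
  rewrite eq_le h2 andbT; rewrite (bigD1 j) //= in s2 G0 *.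
  have := @sumr_ge0 R _ (index_enum (Jsh X)) (fun i => i != j) _ (fun i _ => h2 i).
  lra.
by rewrite expf_eq0 l0.
Qed.

Lemma Gamma'_j_eq0 l x (y : dev_j R X) : (0 < l)%N -> Gamma'_j l x y <= 0 ->
  forall t, w_coord (x t) =1 w_coord (at_t y t).
Proof.
move=> l0 G0 t; apply: (gamma_dev_eq0 l0).
rewrite /Gamma'_j (bigD1 t) //= in G0.
have := @sumr_ge0 R _ (index_enum 'I_(nT X)) (fun i => i != t) _
  (fun i _ => gamma_dev_ge0 l (x i) (at_t y i)).
lra.
Qed.

(* The commitment [uon] determines start-up and shut-down, and [RJ] does not
   involve the only uncopied variables [pon] and [pres]. *)
Lemma RJ_ext j y1 y2 : Xuc D j y1 -> Xuc D j y2 ->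
  (forall t, w_coord (at_t y1 t) =1 w_coord (at_t y2 t)) -> RJ D j y1 = RJ D j y2.
Proof.
move=> [[U1 V1 _ B1] _] [[U2 V2 _ B2] _] H.
have Hp t : ptot (at_t y1 t) = ptot (at_t y2 t).
  exact: (H t (inl (Ordinal (isT : (0 < 5)%N)))).
have Hu t : uon (at_t y1 t) = uon (at_t y2 t).
  exact: (H t (inl (Ordinal (isT : (4 < 5)%N)))).
have Hs t : usu y1 t = usu y2 t /\ usd y1 t = usd y2 t.
  have : usu y1 t - usd y1 t = usu y2 t - usd y2 t.
    by rewrite -U1 -U2 Hu; congr (_ - Defs.prev _ _ _); apply: funext.
  (* Among binary pairs of sum at most 1, the difference determines the pair, since (1, 1) is
     excluded. *)
  have := V1 t; have := V2 t.
  by have [_ [->|->] [->|->]] := B1 t; have [_ [->|->] [->|->]] := B2 t;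
    split; lra.
have Hsu t := (Hs t).1; have Hsd t := (Hs t).2.
have He W : energy D W y1 = energy D W y2.
  by apply: eq_bigr => t _; rewrite Hp.
rewrite /RJ; congr (- _ - _ + _).
- apply: eq_bigr => t _; rewrite Hu Hsu Hsd; congr (_ - _).
  by apply: eq_bigr => t' _; rewrite Hu.
- by congr (_ * (_ + _)); apply: eq_bigr => W _; rewrite He.
- by case: j {U1 V1 B1 U2 V2 B2} => j; [congr (- _)|];
    apply: eq_bigr => t _; rewrite Hp.
Qed.

(** The competitor with zero penalty. Its reserves [p] are left free because they are not copied:
    [x_matches_yd] takes those of the device block, [RT_le_shift] shifted ones. *)
Lemma swap_feasible t x v (y : bar_block R X) (p : Jsd X -> Res X -> R) :
  standing_assumption D -> (forall d u, Xac D (swap_net D x v d u)) ->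
  (forall j, Xuc D j (bdev y j)) -> (forall j, Xsh D j (bush y j t)) ->
  (forall j, Defs.polyP D j t (p_coord (with_pres (at_t (bdev y j) t) (p j)))) ->
  (forall j r, 0 <= p j r) ->
  let x' := swap_net D x v (fun j => with_pres (at_t (bdev y j) t) (p j))
              (bush y ^~ t) in
  ZT_feasible D t x' /\ Gamma_t 2 x' (bar_slice y t) = 0.
Proof.
move=> sa xv Hy Hs Hp p0 x'; split.
  split=> [|j|j]; [exact: xv|exact: Xuc_Yuc|by case: (Hs j)].
rewrite /Gamma_t !big1 ?addr0 // => j _; last exact: eq_gamma_dev.
by rewrite subrr normr0 expr0n.
Qed.

Section cvg.
Context {T : Type} {F : set_system T} {FF : Filter F}.

Lemma gamma_dev_cvg (d d' : T -> dev_jt R X) e e' l :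
  dev_cvg F d e -> dev_cvg F d' e' ->
  gamma_dev l (d x) (d' x) @[x --> F] --> gamma_dev l e e'.
Proof.
move=> de de'; apply: cvg_sum => i _.
elim: l => [|l IHl]; first by under eq_fun do rewrite expr0; exact: cvg_cst.
under eq_fun do rewrite exprS; rewrite exprS; apply: cvgM => //.
by apply: cvg_norm; apply: cvgB; exact: w_coord_cvg.
Qed.

Lemma swap_net_cvg x v (d : T -> Jsd X -> dev_jt R X) d' (u : T -> Jsh X -> R) u' :
  (forall j, dev_cvg F (fun x => d x j) (d' j)) ->
  (forall j, u x j @[x --> F] --> u' j) ->
  net_cvg F (fun n => swap_net D x v (d n) (u n)) (swap_net D x v d' u').
Proof.
move=> dd' uu'; split=> //= j; try exact: cvg_cst.
  by apply: cvgMr_tmp; exact: cvgMl_tmp.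
by apply: cvgMr_tmp; exact: cvgMl_tmp.
Qed.

Lemma with_pres_cvg (d : T -> dev_jt R X) d' p p' : dev_cvg F d d' ->
  (forall r, p x r @[x --> F] --> p' r) ->
  dev_cvg F (fun x => with_pres (d x) (p x)) (with_pres d' p').
Proof. by case. Qed.

End cvg.
End subproblems.

(** * Feasibility and partial optimality of the limit *)

Section limit_point.
Context {R : realType} {X : index_sets} (D : instance R X).
Hypothesis sa : standing_assumption D.
Context {T : Type} {F : set_system T} {FU : UltraFilter F}.
Let PF : ProperFilter F := ultra_proper.
Existing Instance PF.
Local Notation time := 'I_(nT X).

(* [yp n] is the device block of the iteration that precedes [n]. *)
Variables (x : T -> time -> net_t R X) (y yp : T -> bar_block R X) (r : T -> R).
Variables (xs : time -> net_t R X) (ys : bar_block R X).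
Hypothesis x_opt : forall n t, solves_ZT D t (bar_slice (yp n) t) (r n) (x n t).
Hypothesis y_opt : forall n j,
  solves_ZJ D j (fun t => dv (x n t) j) (r n) (bdev (y n) j).
Hypothesis y_round : forall n j t, bush (y n) j t = ZSH D j (ush (x n t) j).
Hypothesis yp_Xuc : forall n j, Xuc D j (bdev (yp n) j).
Hypothesis yp_Xsh : forall n j t, Xsh D j (bush (yp n) j t).
Hypothesis r_gt0 : forall n, 0 < r n.
Hypothesis r_cvg : r @ F --> +oo.
Hypothesis x_cvg : forall t, net_cvg F (x ^~ t) (xs t).
Hypothesis y_cvg : forall j, devj_cvg F (fun n => bdev (y n) j) (bdev ys j).
Hypothesis bush_cvg : forall j t, bush (y n) j t @[n --> F] --> bush ys j t.

Lemma yp_limit : exists yd : bar_block R X,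
  (forall j, devj_cvg F (fun n => bdev (yp n) j) (bdev yd j)) /\
  (forall j t, bush (yp n) j t @[n --> F] --> bush yd j t).
Proof.
have /choice[yd ypd] : forall j, exists y', devj_cvg F (fun n => bdev (yp n) j) y'.
  by move=> j; exact: (Xuc_ultra_cvg (y := fun n => bdev (yp n) j) sa (yp_Xuc^~ j)).
have [bd ypb] : exists l : Jsh X * time -> R,
    forall i, bush (yp n) i.1 i.2 @[n --> F] --> l i.
  apply: (ultra_cvg_fun (a := fun i => (ush_min D i.1)%:R)
    (b := fun i => (ush_max D i.1)%:R)) => n i.
  by case: (yp_Xsh n i.1 i.2).
by exists (BarBlock yd (fun j t => bd (j, t))); split=> // j t; exact: (ypb (j, t)).
Qed.

Section limit_of_previous.
Variable yd : bar_block R X.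
Hypothesis yp_cvg : forall j, devj_cvg F (fun n => bdev (yp n) j) (bdev yd j).
Hypothesis ypb_cvg : forall j t, bush (yp n) j t @[n --> F] --> bush yd j t.

(* The period subproblem can always match the device block exactly, so the
   penalty term is bounded by the variation of [RT], divided by [r]. *)
Lemma x_matches_yd t :
  (forall j, w_coord (dv (xs t) j) =1 w_coord (at_t (bdev yd j) t)) /\
  (forall j, ush (xs t) j = bush yd j t).
Proof.
(* The network state of any feasible point of the original problem will do; its devices and shunt
   steps are replaced by those of [yp n]. *)
have [op [oac _ _]] := sa_feasible sa.
have [v [_ _ xv]] := Xac_swap (oac t).
pose xh n := swap_net D (o_net op t) v
  (fun j => with_pres (at_t (bdev (yp n) j) t) (pres (at_t (bdev (yp n) j) t)))
  (bush (yp n) ^~ t).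
have xhf n : ZT_feasible D t (xh n) /\ Gamma_t 2 (xh n) (bar_slice (yp n) t) = 0.
  apply: swap_feasible => // [j|j r'].
    by case: (yp_Xuc n j) => _ /(_ t)[[_ _ h _] _]; exact: h.
  by case: (yp_Xuc n j) => _ /(_ t)[[_ _ _ [_ _ h]] _]; exact: h.
have xhc : net_cvg F xh (swap_net D (o_net op t) v
    (fun j => with_pres (at_t (bdev yd j) t) (pres (at_t (bdev yd j) t)))
    (bush yd ^~ t)).
  apply: swap_net_cvg => // j; have dd := at_cvg (yp_cvg j) t.
  by apply: with_pres_cvg => //; exact: pres_cvg dd.
have G0 : Gamma_t 2 (xs t) (bar_slice yd t) <= 0.
  apply: (@penalty_limit_le0 _ _ F _ r
    (fun n => Gamma_t 2 (x n t) (bar_slice (yp n) t))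
    (fun n => RT D t (x n t) - RT D t (xh n))) => //.
  - apply: cvgD; apply: cvg_sum => j _.
      by apply: gamma_dev_cvg; [exact: dv_cvg (x_cvg t) j|exact: at_cvg (yp_cvg j) t].
    by apply: cvg_sqr; apply: cvg_norm; apply: cvgB; [exact: (ush_cvg (x_cvg t))|exact: ypb_cvg].
  - by apply: cvgB; apply: RT_cvg; [exact: x_cvg|exact: xhc].
  - move=> n; have [h1 h2] := xhf n; have [_ /(_ _ h1)] := x_opt n t.
    by rewrite h2; lra.
exact: (Gamma_t_eq0 _ G0).
Qed.

Lemma yp_bush_near j t : \forall n \near F, bush (yp n) j t = bush yd j t.
Proof.
apply: cvg_int_near => //; apply: filterE => n.
by case: (yp_Xsh n j t) => _ [k ->]; rewrite natr_int.
Qed.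

(** The steps of [x n] approach those of [yp n], which are integers and eventually constant; once
    the gap is below 1/2, rounding returns these integers. *)
Lemma bush_yd j t : bush ys j t = bush yd j t.
Proof.
have [_ /(_ j) ud] := x_matches_yd t.
have xu : \forall n \near F, `|bush yd j t - ush (x n t) j| < 2^-1.
  by rewrite -ud; apply: cvgr_dist_lt; [exact: (ush_cvg (x_cvg t))|lra].
apply: (cvg_unique _ (bush_cvg (j := j) (t := t))); first exact: norm_hausdorff.
apply: cvg_near_cst; apply: filterS2 xu (yp_bush_near j t) => n xn ypn.
have [_ [k Ek]] := yp_Xsh n j t.
rewrite y_round -ypn Ek; apply: ZSH_round.
- by rewrite -Ek; exact: yp_Xsh.
- by case: (x_opt n t) => -[_ _ h] _; exact: h.
- by rewrite -Ek ypn.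
Qed.

Lemma ys_Xuc j : Xuc D j (bdev ys j).
Proof. by apply: (Xuc_closed (y_cvg j)) => n; case: (y_opt n j). Qed.

(** Here [yp n] competes with [y n]: its own penalty distance tends to 0 by [x_matches_yd], and the
    difference of the [RJ] values converges. *)
Lemma x_matches_ys j t : w_coord (dv (xs t) j) =1 w_coord (at_t (bdev ys j) t).
Proof.
have xd t' := (x_matches_yd t').1 j.
pose G (z : T -> bar_block R X) n := Gamma'_j 1 (fun t => dv (x n t) j) (bdev (z n) j).
have Gc z zs : devj_cvg F (fun n => bdev (z n) j) (bdev zs j) ->
    G z n @[n --> F] --> Gamma'_j 1 (fun t => dv (xs t) j) (bdev zs j).
  move=> zzs; apply: cvg_sum => t' _; apply: gamma_dev_cvg.
    exact: dv_cvg (x_cvg t') j.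
  exact: at_cvg zzs t'.
have Gd : Gamma'_j 1 (fun t => dv (xs t) j) (bdev yd j) = 0.
  by apply: big1 => t' _; exact: eq_gamma_dev.
have [l ly] := RJ_ultra_cvg sa (fun n => (y_opt n j).1).
have [lp lyp] := RJ_ultra_cvg sa (fun n => yp_Xuc n j).
have G0 : Gamma'_j 1 (fun t => dv (xs t) j) (bdev ys j) <= 0.
  suff : Gamma'_j 1 (fun t => dv (xs t) j) (bdev ys j) -
      Gamma'_j 1 (fun t => dv (xs t) j) (bdev yd j) <= 0 by rewrite Gd subr0.
  apply: (@penalty_limit_le0 _ _ F _ r (fun n => G y n - G yp n)
    (fun n => RJ D j (bdev (y n) j) - RJ D j (bdev (yp n) j))) => //.
  - by apply: cvgB; exact: Gc.
  - exact: cvgB ly lyp.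
  - by move=> n; have [_ /(_ _ (yp_Xuc n j))] := y_opt n j; rewrite /G; lra.
exact: (Gamma'_j_eq0 _ G0).
Qed.

Lemma xs_feasible t : ZT_feasible D t (xs t).
Proof.
split=> [|j|j].
- by apply: (Xac_closed (x_cvg t)) => n; case: (x_opt n t) => -[].
- by apply: (Yuc_closed (dv_cvg (x_cvg t) j)) => n; case: (x_opt n t) => -[].
- apply: (cvg_itv (ush_cvg (x_cvg t) (j := j))) => n.
  by case: (x_opt n t) => -[_ _ h] _; exact: h.
Qed.

(** The shift is applied to [yp n] rather than to its limit, so that every competitor has zero
    penalty; [lam < 1] makes it eventually feasible. *)
Lemma RT_le_shift t x' lam : ZT_feasible D t x' ->
  (forall j, w_coord (dv x' j) =1 w_coord (at_t (bdev yd j) t)) ->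
  (forall j, ush x' j = bush yd j t) -> 0 <= lam < 1 ->
  forall v, (forall d u, Xac D (swap_net D x' v d u)) ->
  RT D t (swap_net D x' v (fun j => with_pres (at_t (bdev yd j) t)
    (fun r' => pres (at_t (bdev yd j) t) r' +
       lam * (pres (dv x' j) r' - pres (at_t (bdev yd j) t) r')))
    (bush yd ^~ t)) <= RT D t (xs t).
Proof.
move=> [_ x'Y _] x'w x'u lam01 v xv.
have dc j := at_cvg (yp_cvg j) t.
have ydX j : Xuc D j (bdev yd j) by exact: Xuc_closed (yp_cvg j) _.
pose p n j r' := pres (at_t (bdev (yp n) j) t) r' +
  lam * (pres (dv x' j) r' - pres (at_t (bdev yd j) t) r').
have p_polyP : \forall n \near F, forall j,
    Defs.polyP D j t (p_coord (with_pres (at_t (bdev (yp n) j) t) (p n j))).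
  apply: filter_forall => j.
  have [_ [_ [_ [_ _ [x'P1 x'P3 _] _ _]]]] := x'Y j.
  have [_ /(_ t)[[ydP1 _ ydP3 _] _]] := ydX j.
  have pc i : p_coord (at_t (bdev (yp n) j) t) i @[n --> F]
      --> p_coord (at_t (bdev yd j) t) i by exact: p_coord_cvg.
  have pn : \forall n \near F, Defs.polyP D j t (p_coord (at_t (bdev (yp n) j) t)).
    by apply: filterE => n; case: (yp_Xuc n j) => _ /(_ t)[[]].
  apply: filterS (polyhedral_shift (polyP_polyhedral D j t) pc pn ydP3 x'P3 lam01).
  move=> n; congr (Defs.polyP D j t _); apply: funext.
  (* [x'] and [yd] share the copied coordinates, and (P1) then forces equal [pon], so the shift
     moves the reserves only. *)
  have e k (lk : (k < 5)%N) := x'w j (inl (Ordinal lk)).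
  have e0 := e 0%N isT; have e1 := e 1%N isT; have e2 := e 2%N isT.
  have e4 := e 4%N isT; move: e0 e1 e2 e4 => /= e0 e1 e2 e4.
  move: x'P1 ydP1; rewrite /con_P1 => x'P1 ydP1.
  have en : pon (dv x' j) = pon (at_t (bdev yd j) t) by lra.
  by move=> [[[|[|[|k]]] lk]|r'] //=; rewrite ?e0 ?e4 ?en subrr mulr0 addr0.
have p_ge0 : \forall n \near F, forall j r', 0 <= p n j r'.
  apply: filter_forall => j; apply: filter_forall => r'.
  have [_ [_ [_ [_ _ [_ _ [_ _ x'0]] _ _]]]] := x'Y j.
  have [_ /(_ t)[[_ _ _ [_ _ yd0]] _]] := ydX j.
  (* Nonnegativity is put as [- pres <= 0] to fit [near_shift_le] with bound 0. *)
  have pc : - pres (at_t (bdev (yp n) j) t) r' @[n --> F]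
      --> - pres (at_t (bdev yd j) t) r' by apply: cvgN; exact: (pres_cvg (dc j)).
  have pn : \forall n \near F, - pres (at_t (bdev (yp n) j) t) r' <= 0.
    apply: filterE => n; rewrite oppr_le0.
    by case: (yp_Xuc n j) => _ /(_ t)[[_ _ _ [_ _ h]] _]; exact: h.
  have x'0' : - pres (dv x' j) r' <= 0 by rewrite oppr_le0.
  have yd0' : - pres (at_t (bdev yd j) t) r' <= 0 by rewrite oppr_le0.
  by apply: filterS (near_shift_le pc pn yd0' x'0' lam01) => n; rewrite /p; lra.
pose xx n := swap_net D x' v
  (fun j => with_pres (at_t (bdev (yp n) j) t) (p n j)) (bush (yp n) ^~ t).
rewrite -subr_le0.
apply: (@cvgr_to_le _ F _ _ (fun n => RT D t (xx n) - RT D t (x n t))).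
  apply: cvgB; apply: RT_cvg; last exact: x_cvg.
  apply: swap_net_cvg => // j; apply: with_pres_cvg => // r'.
  by apply: cvgD; [exact: (pres_cvg (dc j))|exact: cvg_cst].
apply: filterS2 p_polyP p_ge0 => n np np0.
have [h1 h2] := swap_feasible sa xv (yp_Xuc n) (fun j => yp_Xsh n j t) np np0.
have [_ /(_ _ h1)] := x_opt n t; rewrite -/(xx n) in h2 *; rewrite h2.
(* The penalty of [x n] is nonnegative and that of the competitor is 0, so optimality compares the
   values of [RT] alone. *)
have := Gamma_t_ge0 2 (x n t) (bar_slice (yp n) t).
have := r_gt0 n; nra.
Qed.

(** At [lam = 1] the shifted network is [x'] itself; continuity of [RT] reaches this case from
    [lam < 1]. *)
Lemma xs_optimal t x' : ZT_feasible D t x' ->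
  (forall j, w_coord (dv x' j) =1 w_coord (at_t (bdev ys j) t)) ->
  (forall j, ush x' j = bush ys j t) -> RT D t x' <= RT D t (xs t).
Proof.
move=> x'f x'w x'u.
have {}x'w j : w_coord (dv x' j) =1 w_coord (at_t (bdev yd j) t).
  by move=> i; rewrite x'w -x_matches_ys; case: (x_matches_yd t) => ->.
have {}x'u j : ush x' j = bush yd j t by rewrite x'u bush_yd.
have [x'ac _ _] := x'f; have [v [x'p x'q xv]] := Xac_swap x'ac.
apply: (@cvgr_to_le _ (1 : R)^'- _ _ (fun lam : R =>
  RT D t (swap_net D x' v (fun j => with_pres (at_t (bdev yd j) t)
    (fun r' => pres (at_t (bdev yd j) t) r' +
       lam * (pres (dv x' j) r' - pres (at_t (bdev yd j) t) r')))
    (bush yd ^~ t)))); last first.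
  have l0 : \forall l \near (1 : R)^'-, 0 <= l by apply: nbhs_left_ge.
  have l1 : \forall l \near (1 : R)^'-, l < 1 by apply: nbhs_left_lt.
  apply: filterS2 l0 l1 => l l0 l1; apply: RT_le_shift => //.
  by rewrite l0.
have lc : lam @[lam --> (1 : R)^'-] --> (1 : R) by exact: cvg_at_left_filter.
have cst (a b : R) : a = b -> (fun=> a) l @[l --> (1 : R)^'-] --> b.
  by move=> ->; exact: cvg_cst.
apply: RT_cvg; split=> [j|j|j|j|j|j|j|j] /=; try exact: cvg_cst.
- have e k (lk : (k < 5)%N) := esym (x'w j (inl (Ordinal lk))).
  have [_ [_ [_ [_ _ [x'P1 _ _] _ _]]]] : Yuc D j t (dv x' j) by case: x'f.
  have ydX : Xuc D j (bdev yd j) by exact: Xuc_closed (yp_cvg j) _.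
  have [_ /(_ t)[[ydP1 _ _ _] _]] := ydX.
  have e0 := e 0%N isT; have e1 := e 1%N isT; have e2 := e 2%N isT.
  have e3 := e 3%N isT; have e4 := e 4%N isT.
  move: e0 e1 e2 e3 e4 => /= e0 e1 e2 e3 e4.
  move: x'P1 ydP1; rewrite /con_P1 => x'P1 ydP1.
  split=> [||||r'||r'|] /=; try exact: cst.
  + by apply: cst; lra.
  + rewrite -[X in _ --> X](subrKC (pres (at_t (bdev yd j) t) r')).
    apply: cvgD; first exact: cvg_cst.
    by rewrite -[X in _ --> X]mul1r; exact: cvgMr_tmp.
  + by apply: cst; exact: esym (x'w j (inr r')).
- by apply: cst; rewrite x'p x'u.
- by apply: cst; rewrite x'q x'u.
- by apply: cst; rewrite x'u.
Qed.

End limit_of_previous.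

Lemma limit_partial_optimum : partial_optimum D (xs, ys).
Proof.
have [yd [ypd ypb]] := yp_limit.
have sf : copy_feasible D (xs, ys).
  split=> /= [t|j|j t|j t|j t].
  - exact: xs_feasible.
  - exact: ys_Xuc.
  - rewrite (bush_yd ypd ypb).
    by have /filter_ex[n <-] := yp_bush_near ypb j t.
  - exact: (x_matches_ys ypd ypb).
  - by rewrite (bush_yd ypd ypb); case: (x_matches_yd ypd ypb t).
split=> //; split; try by split.
  (* With the unbarred block fixed, all feasible barred blocks share the same [w], hence the same
     objective value. *)
  move=> [x' y'] [[/= _ y'X _ y'w _] /= Ex]; subst x'.
  rewrite /copy_objective lerD2l /=; apply: ler_sum => j _.
  rewrite (@RJ_ext _ _ D j (bdev y' j) (bdev ys j)) //; first exact: ys_Xuc.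
  by move=> t i; rewrite -y'w (x_matches_ys ypd ypb).
(* With the barred block fixed, the problem separates over the periods. *)
move=> [x' y'] [[/= x'f _ _ x'w x'u] /= Ey]; subst y'.
rewrite /copy_objective lerD2r /=; apply: ler_sum => t _.
by apply: (xs_optimal ypd ypb).
Qed.

End limit_point.

(** * From a subsequence of iterates to an ultrafilter *)

Theorem theorem2 (R : realType) (X : index_sets) (D : instance R X)
    (HD : standing_assumption D)
    (rho : nat -> R)
    (rho_gt0 : forall n, (1 <= n)%N -> 0 < rho n)
    (rho_cvg : rho n @[n --> \oo] --> +oo)
    (z : nat -> copy_point R X)
    (Hz : padm_iterates D rho z)
    (zstar : copy_point R X)
    (Hstar : seq_limit_point z zstar) :
  partial_optimum D zstar.
Proof.
case: zstar Hstar => xs ys [s s_mono [/= cx cy cb]].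
have ge_s n : (n <= s n)%N.
  by elim: n => // n /leq_ltn_trans; apply; exact: s_mono.
have [F [FU sF]] := @ultraFilterLemma nat \oo _.
(* Two terms are dropped: [s n.+2 >= 2] ensures that the penalized subproblem applies and that the
   preceding index is at least 1. *)
have shift (u : nat -> R) (l : R) :
    u (s n) @[n --> \oo] --> l -> u (s n.+2) @[n --> F] --> l.
  rewrite -(cvg_shiftn 2 (fun n => u (s n))) => ul.
  have -> : (fun n => u (s n.+2)) = (fun n => u (s (n + 2)%N)).
    by apply: funext => n; rewrite addn2.
  by move=> A /ul /sF.
have dshift (d : nat -> dev_jt R X) d' : cvg_dev_jt (fun n => d (s n)) d' ->
    dev_cvg F (fun n => d (s n.+2)) d'.
  move=> [[dp dn du dd dr] [dq ds don]]; split=> [||||r||r|].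
  - exact: (shift (fun n => ptot (d n))).
  - exact: (shift (fun n => pon (d n))).
  - exact: (shift (fun n => psu (d n))).
  - exact: (shift (fun n => psd (d n))).
  - exact: (shift (fun n => pres (d n) r)).
  - exact: (shift (fun n => qtot (d n))).
  - exact: (shift (fun n => qres (d n) r)).
  - exact: (shift (fun n => uon (d n))).
have s2 n : (1 < s n.+2)%N by exact: leq_ltn_trans (ge_s n.+2).
have s1 n : (0 < (s n.+2).-1)%N by rewrite -ltnS prednK // ltnW.
have rho_s : rho (s n.+2) @[n --> F] --> +oo.
  apply/cvgryPgt => A.
  have /cvgryPgt/(_ A)[N _ HN] := rho_cvg.
  apply: sF; exists N => // n /= Nn; apply: HN => /=.
  by rewrite (leq_trans Nn) // (leq_trans _ (ge_s _)) // leqW.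
apply: (@limit_partial_optimum _ _ D HD _ F _ (fun n => (z (s n.+2)).1)
  (fun n => (z (s n.+2)).2) (fun n => (z (s n.+2).-1).2) (fun n => rho (s n.+2))).
- move=> n t; have [/(_ t)] := Hz _ (ltnW (s2 n)).
  by rewrite gtn_eqF.
- by move=> n j; have [_ /(_ j)] := Hz _ (ltnW (s2 n)).
- by move=> n j t; have [_ _ /(_ j t)] := Hz _ (ltnW (s2 n)).
- by move=> n j; have [_ /(_ j)[]] := Hz _ (s1 n).
(* The preceding iterate may be the first one; the initial and the penalized subproblem have the
   same feasible set. *)
- move=> n j t; have [xo _ ->] := Hz _ (s1 n); apply: Xsh_ZSH.
  by move: (xo t); case: ifP => _ [[_ _ h] _]; exact: h.
- by move=> n; exact: rho_gt0 _ (ltnW (s2 n)).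
- exact: rho_s.
- move=> t; have [cd cn cs] := cx t; split=> j.
  + exact: (dshift (fun n => dv ((z n).1 t) j)).
  + by have [? ? ? ?] := cn j; apply: (shift (fun n => pfr ((z n).1 t) j)).
  + by have [? ? ? ?] := cn j; apply: (shift (fun n => pto ((z n).1 t) j)).
  + by have [? ? ? ?] := cn j; apply: (shift (fun n => qfr ((z n).1 t) j)).
  + by have [? ? ? ?] := cn j; apply: (shift (fun n => qto ((z n).1 t) j)).
  + by have [? ? ?] := cs j; apply: (shift (fun n => psh ((z n).1 t) j)).
  + by have [? ? ?] := cs j; apply: (shift (fun n => qsh ((z n).1 t) j)).
  + by have [? ? ?] := cs j; apply: (shift (fun n => ush ((z n).1 t) j)).
- move=> j; split=> t; have [cd cu cv] := cy j t.
  + exact: (dshift (fun n => at_t (bdev (z n).2 j) t)).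
  + exact: (shift (fun n => usu (bdev (z n).2 j) t)).
  + exact: (shift (fun n => usd (bdev (z n).2 j) t)).
- by move=> j t; exact: (shift (fun n => bush (z n).2 j t)).
Qed.
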